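(* Let $\mathbb{M}=(M_p)_{p\in\mathbb{N}_0}$ be a weight sequence, $\gamma>0$, and let $G_\gamma$ be a sectorial region bisected by direction $0$ and of opening $\pi\gamma$. The following statements are equivalent: (i) The Borel map $\widetilde{\mathcal{B}}:\widetilde{\mathcal{A}}_{\mathbb{M}}(G_\gamma)\to\mathbb{C}[[z]]_{\mathbb{M}}$ is injective. (ii) $\gamma>\omega(\mathbb{M})$.
   Context: Sequences. $\mathbb{N}_0=\{0,1,2,\dots\}$. A weight sequence is a sequence $\mathbb{M}=(M_p)_{p\in\mathbb{N}_0}$ of positive reals with $M_0=1$, logarithmically convex ($M_p^2\le M_{p-1}M_{p+1}$ for $p\ge1$), whose sequence of quotients $m_p:=M_{p+1}/M_p$ tends to $\infty$. Its index is $\omega(\mathbb{M}):=\liminf_{p\to\infty}\frac{\log m_p}{\log p}\in[0,\infty]$. Regions. $\mathcal{R}$ is the Riemann surface of the logarithm. For $d\in\mathbb{R}$, $\alpha,r>0$ put $S(d,\alpha,r)=\{z\in\mathcal{R}:|\arg z-d|<\alpha\pi/2,\ |z|<r\}$ and $S(d,\alpha)=\{z\in\mathcal{R}:|\arg z-d|<\alpha\pi/2\}$. A sectorial region $G_\alpha$ (bisected by direction $0$, opening $\pi\alpha$) is a connected open set $G_\alpha\subset\mathcal{R}$ with $G_\alpha\subset S(0,\alpha)$ such that for every $\beta\in(0,\alpha)$ there is $\rho>0$ with $S(0,\beta,\rho)\subset G_\alpha$. A bounded sector $T$ (some $S(d,\beta,r)$) is a proper subsector of $G$, written $T\ll G$,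 if its closure in $\mathcal{R}$ (so the vertex $0$ is not considered) is contained in $G$. Classes. $\widetilde{\mathcal{A}}_{\mathbb{M}}(G)$ is the space of holomorphic $f:G\to\mathbb{C}$ admitting an $\mathbb{M}$-asymptotic expansion: there is a formal power series $\widehat f=\sum_{p\ge0}a_pz^p$ such that for every $T\ll G$ there are $C_T,A_T>0$ with $|f(z)-\sum_{n=0}^{p-1}a_nz^n|\le C_TA_T^pM_p|z|^p$ for all $z\in T$, $p\in\mathbb{N}_0$. The series $\widehat f$ is unique. $\mathbb{C}[[z]]_{\mathbb{M}}$ is the set of $\sum a_pz^p\in\mathbb{C}[[z]]$ for which there is $A>0$ with $\sup_p|a_p|/(A^pM_p)<\infty$. The asymptotic Borel map is $\widetilde{\mathcal{B}}(f)=\widehat f$. *)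

(* Defs.v *)
From Stdlib Require Import Reals Lra Lia ClassicalEpsilon FunctionalExtensionality.
From Coquelicot Require Import Coquelicot.
Open Scope R_scope.

Definition quotient (M : nat -> R) (p : nat) : R := M (S p) / M p.

Definition weight_sequence (M : nat -> R) : Prop :=
  (forall p, 0 < M p) /\
  M 0%nat = 1 /\
  (forall p, (1 <= p)%nat -> M p ^ 2 <= M (p - 1)%nat * M (p + 1)%nat) /\
  is_lim_seq (quotient M) p_infty.

(* The terms p = 0, 1, where ln p = 0 (with ln 0 = 0 by convention in the
   library), do not affect the lower limit. *)
Definition omega (M : nat -> R) : Rbar :=
  LimInf_seq (fun p => ln (quotient M p) / ln (INR p)).

(* The Riemann surface of the logarithm, in its global chart log: the point
   z = |z| e^{i arg z} is represented by log z = ln |z| + i arg z, which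
   ranges over the whole complex plane. *)
Definition LogSurface : UniformSpace := C_UniformSpace.

Definition modulus (z : LogSurface) : R := exp (Re z).
Definition argument (z : LogSurface) : R := Im z.

(* The covering projection onto the punctured complex plane. *)
Definition proj (z : LogSurface) : C :=
  (modulus z * cos (argument z), modulus z * sin (argument z)).

Definition closure {T : UniformSpace} (A : T -> Prop) (x : T) : Prop :=
  forall P : T -> Prop, locally x P -> exists y, P y /\ A y.

Definition connected {T : UniformSpace} (A : T -> Prop) : Prop :=
  forall U V : T -> Prop, open U -> open V ->
    (forall x, A x -> U x \/ V x) ->
    (exists x, A x /\ U x) -> (exists x, A x /\ V x) ->
    exists x, A x /\ U x /\ V x.

Definition sector (d alpha : R) (z : LogSurface) : Prop :=
  Rabs (argument z - d) < alpha * PI / 2.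

Definition bounded_sector (d alpha r : R) (z : LogSurface) : Prop :=
  Rabs (argument z - d) < alpha * PI / 2 /\ modulus z < r.

Definition sectorial_region (alpha : R) (G : LogSurface -> Prop) : Prop :=
  open G /\ connected G /\
  (forall z, G z -> sector 0 alpha z) /\
  (forall beta, 0 < beta < alpha ->
    exists rho, 0 < rho /\ forall z, bounded_sector 0 beta rho z -> G z).

Definition proper_subsector (T G : LogSurface -> Prop) : Prop :=
  (exists d beta r, 0 < beta /\ 0 < r /\
     forall z, T z <-> bounded_sector d beta r z) /\
  (forall z, closure T z -> G z).

(* Functions on G are total functions of which only the values on G matter.
   Since log is a global holomorphic chart of the surface, holomorphy on the
   open set G is complex differentiability in that chart. *)
Definition holomorphic_on (G : LogSurface -> Prop) (f : LogSurface -> C) : Prop :=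
  forall z, G z -> @ex_derive C_AbsRing C_NormedModule f z.

Definition power_series := nat -> C.

(* a_0 + a_1 z + ... + a_{p-1} z^{p-1} *)
Fixpoint partial_sum (a : power_series) (z : C) (p : nat) : C :=
  match p with
  | O => 0
  | S q => (partial_sum a z q + a q * Cpow z q)%C
  end.

Definition asymptotic_expansion (M : nat -> R) (G : LogSurface -> Prop)
    (f : LogSurface -> C) (a : power_series) : Prop :=
  forall T, proper_subsector T G ->
    exists CT AT, 0 < CT /\ 0 < AT /\
      forall z p, T z ->
        Cmod (f z - partial_sum a (proj z) p)%C
          <= CT * AT ^ p * M p * modulus z ^ p.

Definition in_class (M : nat -> R) (G : LogSurface -> Prop)
    (f : LogSurface -> C) : Prop :=
  holomorphic_on G f /\ exists a, asymptotic_expansion M G f a.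

Definition in_power_series_class (M : nat -> R) (a : power_series) : Prop :=
  exists A, 0 < A /\ exists K, forall p, Cmod (a p) / (A ^ p * M p) <= K.

(* The asymptotic expansion is unique when G is a sectorial region
   (asymptotic_expansion_unique), so the choice is immaterial on the class. *)
Definition borel_map (M : nat -> R) (G : LogSurface -> Prop)
    (f : LogSurface -> C) : power_series :=
  @epsilon power_series (inhabits (fun _ => RtoC 0))
    (asymptotic_expansion M G f).

Definition borel_map_injective (M : nat -> R) (G : LogSurface -> Prop) : Prop :=
  forall f g, in_class M G f -> in_class M G g ->
    borel_map M G f = borel_map M G g -> forall z, G z -> f z = g z.

Lemma closure_bounded_sector (d b r b' r' : R) (z : LogSurface) :
  b < b' -> 0 < r < r' -> closure (bounded_sector d b r) z ->
  bounded_sector d b' r' z.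
Proof.
intros Hb [Hr Hr'] Hz.
assert (HPI := PI_RGT_0).
assert (Hln : ln r < ln r') by (apply ln_increasing; lra).
assert (He : 0 < Rmin ((b' - b) * PI / 2) (ln r' - ln r)).
{ apply Rmin_pos; [apply Rmult_lt_0_compat; [apply Rmult_lt_0_compat|]|]; lra. }
destruct (Hz _ (locally_ball z (mkposreal _ He))) as [w [[Hw1 Hw2] [Hs Hm]]].
unfold ball in Hw1, Hw2; simpl in Hw1, Hw2.
unfold AbsRing_ball, abs, minus, plus, opp in Hw1, Hw2; simpl in Hw1, Hw2.
assert (E1 := Rmin_l ((b' - b) * PI / 2) (ln r' - ln r)).
assert (E2 := Rmin_r ((b' - b) * PI / 2) (ln r' - ln r)).
unfold argument, Im in Hs. unfold modulus, Re in Hm.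
split; unfold argument, modulus, Re, Im.
- apply Rabs_def2 in Hs. apply Rabs_def2 in Hw2. apply Rabs_def1; lra.
- assert (Hlt : fst w < ln r).
  { rewrite <- (ln_exp (fst w)). apply ln_increasing; [apply exp_pos | exact Hm]. }
  apply Rabs_def2 in Hw1.
  rewrite <- (exp_ln r') by lra. apply exp_increasing. lra.
Qed.

Lemma exists_proper_subsector (gamma : R) (G : LogSurface -> Prop) :
  0 < gamma -> sectorial_region gamma G ->
  exists b r, 0 < b /\ 0 < r /\ proper_subsector (bounded_sector 0 b r) G.
Proof.
intros Hg (_ & _ & _ & H).
destruct (H (gamma / 2)) as [rho [Hrho Hin]]; [lra|].
exists (gamma / 4), (rho / 2). split; [lra|]. split; [lra|]. split.
- exists 0, (gamma / 4), (rho / 2). split; [lra|]. split; [lra|]. tauto.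
- intros z Hz. apply Hin. revert Hz. apply closure_bounded_sector; lra.
Qed.

Lemma Cmod_proj (z : LogSurface) : Cmod (proj z) = modulus z.
Proof.
unfold Cmod, proj; simpl.
replace (_ + _) with (Rsqr (modulus z) *
  (Rsqr (sin (argument z)) + Rsqr (cos (argument z)))) by (unfold Rsqr; ring).
rewrite sin2_cos2, Rmult_1_r. apply sqrt_Rsqr, Rlt_le, exp_pos.
Qed.

Lemma bounded_sector_point (b r t : R) : 0 < b -> 0 < t < r ->
  bounded_sector 0 b r (ln t, 0) /\ modulus (ln t, 0) = t.
Proof.
intros Hb Ht. assert (HPI := PI_RGT_0).
unfold bounded_sector, modulus, argument; simpl.
rewrite exp_ln by lra. split; [split; [|lra] | reflexivity].
rewrite Rminus_diag, Rabs_R0. apply Rmult_lt_0_compat; [|lra].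
apply Rmult_lt_0_compat; lra.
Qed.

Lemma affine_bound (x a b r : R) : 0 < r -> 0 <= b ->
  (forall t, 0 < t < r -> x <= a + b * t) -> x <= a.
Proof.
intros Hr Hb H. apply Rnot_lt_le; intro Hlt.
set (t := Rmin (r / 2) ((x - a) / (2 * (b + 1)))).
assert (Hq : 0 < (x - a) / (2 * (b + 1))) by (apply Rdiv_lt_0_compat; lra).
assert (T1 := Rmin_l (r / 2) ((x - a) / (2 * (b + 1)))).
assert (T2 := Rmin_r (r / 2) ((x - a) / (2 * (b + 1)))).
assert (T0 : 0 < t) by (apply Rmin_pos; lra).
fold t in T1, T2.
specialize (H t ltac:(lra)).
assert (b * t <= (b + 1) * ((x - a) / (2 * (b + 1)))).
{ apply Rmult_le_compat; lra. }
replace ((b + 1) * ((x - a) / (2 * (b + 1)))) with ((x - a) / 2) in H0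
  by (field; lra).
lra.
Qed.

Lemma asymptotic_expansion_unique (M : nat -> R) (gamma : R)
    (G : LogSurface -> Prop) (f : LogSurface -> C) (a b : power_series) :
  weight_sequence M -> 0 < gamma -> sectorial_region gamma G ->
  asymptotic_expansion M G f a -> asymptotic_expansion M G f b -> a = b.
Proof.
intros [HM _] Hg HG Ha Hb.
destruct (exists_proper_subsector _ _ Hg HG) as (be & r & Hbe & Hr & HT).
destruct (Ha _ HT) as (C1 & A1 & HC1 & HA1 & E1).
destruct (Hb _ HT) as (C2 & A2 & HC2 & HA2 & E2).
apply functional_extensionality; intro p.
induction p as [p IH] using (well_founded_induction Wf_nat.lt_wf).
assert (Hs : forall z q, (q <= p)%nat -> partial_sum a z q = partial_sum b z q).
{ intros z q; induction q as [|q IHq]; intros Hq; simpl; [reflexivity|].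
  rewrite IHq by lia. rewrite IH by lia. reflexivity. }
set (K1 := C1 * A1 ^ S p * M (S p)). set (K2 := C2 * A2 ^ S p * M (S p)).
assert (HK1 : 0 < K1).
{ apply Rmult_lt_0_compat; [apply Rmult_lt_0_compat|]; auto using pow_lt. }
assert (HK2 : 0 < K2).
{ apply Rmult_lt_0_compat; [apply Rmult_lt_0_compat|]; auto using pow_lt. }
assert (H0 : Cmod (a p - b p)%C <= 0).
{ apply (affine_bound _ _ (K1 + K2) r); [lra | lra |]. intros t Ht.
  destruct (bounded_sector_point be r t Hbe Ht) as [Hz Hmt].
  set (z := (ln t, 0) : LogSurface) in *.
  specialize (E1 z (S p) Hz). specialize (E2 z (S p) Hz).
  fold K1 in E1. fold K2 in E2. rewrite Hmt in E1, E2. simpl in E1, E2.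
  rewrite Hs in E1 by lia.
  assert (Htri := Cmod_triangle (f z - (partial_sum b (proj z) p + b p * Cpow (proj z) p))%C
    (- (f z - (partial_sum b (proj z) p + a p * Cpow (proj z) p)))%C).
  rewrite Cmod_opp in Htri.
  replace (f z - (partial_sum b (proj z) p + b p * Cpow (proj z) p) +
    - (f z - (partial_sum b (proj z) p + a p * Cpow (proj z) p)))%C
    with ((a p - b p) * Cpow (proj z) p)%C in Htri by ring.
  rewrite Cmod_mult, Cmod_pow, Cmod_proj, Hmt in Htri.
  assert (Hp : 0 < t ^ p) by (apply pow_lt; lra).
  apply (Rmult_le_reg_r (t ^ p)); [exact Hp|].
  replace ((0 + (K1 + K2) * t) * t ^ p) with
    (K2 * (t * t ^ p) + K1 * (t * t ^ p)) by ring.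
  lra. }
assert (Hz : (a p - b p)%C = 0%C) by (apply Cmod_eq_0, Rle_antisym; [exact H0 | apply Cmod_ge_0]).
replace (a p) with ((a p - b p) + b p)%C by ring. rewrite Hz. ring.
Qed.

Lemma borel_map_spec (M : nat -> R) (G : LogSurface -> Prop)
    (f : LogSurface -> C) :
  in_class M G f -> asymptotic_expansion M G f (borel_map M G f).
Proof. intros [_ H]. exact (epsilon_spec _ _ H). Qed.

Lemma borel_map_range (M : nat -> R) (gamma : R) (G : LogSurface -> Prop)
    (f : LogSurface -> C) :
  weight_sequence M -> 0 < gamma -> sectorial_region gamma G ->
  in_class M G f -> in_power_series_class M (borel_map M G f).
Proof.
intros [HM _] Hg HG Hf. apply borel_map_spec in Hf.
set (a := borel_map M G f) in *; clearbody a.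
destruct (exists_proper_subsector _ _ Hg HG) as (be & r & Hbe & Hr & HT).
destruct (Hf _ HT) as (K & A & HK & HA & E).
exists A; split; [exact HA|]. exists K; intro p.
assert (HAM : 0 < A ^ p * M p) by (apply Rmult_lt_0_compat; auto using pow_lt).
apply Rle_div_l; [exact HAM|].
assert (HAM' : 0 < K * A ^ S p * M (S p)).
{ apply Rmult_lt_0_compat; [apply Rmult_lt_0_compat|]; auto using pow_lt. }
apply (affine_bound _ _ (K * A ^ S p * M (S p)) r); [lra | lra |]. intros t Ht.
destruct (bounded_sector_point be r t Hbe Ht) as [Hz Hmt].
set (z := (ln t, 0) : LogSurface) in *.
assert (E1 := E z p Hz). assert (E2 := E z (S p) Hz).
rewrite Hmt in E1, E2.
assert (Htri := Cmod_triangle (f z - partial_sum a (proj z) p)%C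
  (- (f z - partial_sum a (proj z) (S p)))%C).
rewrite Cmod_opp in Htri.
replace (f z - partial_sum a (proj z) p + - (f z - partial_sum a (proj z) (S p)))%C
  with (a p * Cpow (proj z) p)%C in Htri by (simpl; ring).
rewrite Cmod_mult, Cmod_pow, Cmod_proj, Hmt in Htri.
assert (Hp : 0 < t ^ p) by (apply pow_lt; lra).
apply (Rmult_le_reg_r (t ^ p)); [exact Hp|].
replace ((K * (A ^ p * M p) + K * A ^ S p * M (S p) * t) * t ^ p) with
  (K * A ^ p * M p * t ^ p + K * A ^ S p * M (S p) * t ^ S p) by (simpl; ring).
lra.
Qed.

(* Main.v *)
Require Import Defs.
From Stdlib Require Import Reals Lra Lia ClassicalEpsilon FunctionalExtensionality.
From Coquelicot Require Import Coquelicot.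
Open Scope R_scope.

(* In the chart z = exp s, put h = f - g for two functions with the same expansion. If
   omega(M) < g < b < gamma, then M_p <= p^(g p) for infinitely many p, so the flatness
   bound of order p gives |h| <= C exp(-p) where |z| = const p^(-g). The maximum principle
   for h exp(L z^(-1/b)) on long rectangles in the chart bounds this product by its values
   at fixed |z|, for every L > 0; letting L grow, h vanishes near the vertex, hence
   everywhere by the identity theorem. The maximum principle itself comes from Goursat's
   theorem on rectangles, read in exponential coordinates around a point.

   Conversely, if gamma <= omega(M), then sup_p (p y - ln M_p) <= C_k exp(l_k y / gamma) for
   exponents l_k decreasing to 1. With weights c_k small enough against the C_k, the sum
   E(s) = sum_k c_k exp(l_k s) has no zero for |Im s| < pi/2, and exp(-1/E(s/gamma)) is a
   nonzero function with vanishing expansion: on |Im s| <= theta < pi/2, the terms with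
   l_k theta >= pi/2, finite in number, are negligible near the vertex. *)

(** * Complex differentiability *)

(** Both halves turn on the gap between the lower limit that defines omega and a bound valid for all
    p. If omega < gamma, M_p <= p^(g p) is known only along a sequence of p, so there is no decay
    estimate at every modulus; the maximum principle needs just one left side for each such p, and
    these sides recede to the vertex. The intermediate b makes this work: at |z| = const p^(-g) the
    weight is at most exp(const L p^(g/b)), and since g/b < 1 the factor exp(-p) beats it for each
    fixed L.

    If gamma <= omega, the delicate case is equality: every l > 1 gives a bound by a multiple of
    exp(l y / gamma), but l = 1 may fail. A single exponent l would give exp(-c exp(-l s)), which
    decays only for |Im s| < pi/(2 l), a sector too narrow. Exponents decreasing to 1 together reach
    every opening below pi, while on the real axis 1/E still dominates all p y - ln M_p with y = -
    gamma s. Keeping the exponents at most 3/2 prevents the terms from cancelling, so that E has no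
    zero. *)

Definition holo_at (f : C -> C) (z : C) : Prop :=
  @ex_derive C_AbsRing (AbsRing_NormedModule C_AbsRing) f z.

Lemma holo_at_eps (f : C -> C) (z : C) :
  holo_at f z <->
  exists l, forall eps, 0 < eps -> exists delta, 0 < delta /\
    forall w, Cmod (w - z)%C < delta ->
      Cmod (f w - f z - l * (w - z))%C <= eps * Cmod (w - z)%C.
Proof.
split.
- intros [l [_ H]]. exists l; intros eps He.
  destruct (H z (fun P HP => HP) (mkposreal eps He)) as [d Hd].
  exists d; split; [apply cond_pos|]. intros w Hw.
  specialize (Hd w Hw).
  unfold norm, minus, plus, opp, scal in Hd; simpl in Hd.
  unfold mult in Hd; simpl in Hd. unfold Cminus in *.
  rewrite (Cmult_comm l). exact Hd.
- intros [l H]. exists l. split; [apply is_linear_scal_l|].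
  intros x Hx eps.
  assert (Hzx := @is_filter_lim_locally_unique C_AbsRing (AbsRing_NormedModule C_AbsRing) z x Hx). simpl in Hzx. subst x.
  destruct (H eps (cond_pos eps)) as [d [Hd0 Hd]].
  exists (mkposreal d Hd0). intros w Hw. specialize (Hd w Hw).
  unfold norm, minus, plus, opp, scal; simpl.
  unfold mult; simpl. unfold Cminus in *.
  rewrite (Cmult_comm l) in Hd. exact Hd.
Qed.

(** The two sides differ only in the normed module put on C; [holo_at] takes that of the ring
    itself, in which the product and chain rules are stated. *)
Lemma ex_derive_holo_at (f : C -> C) (z : C) :
  @ex_derive C_AbsRing C_NormedModule f z <-> holo_at f z.
Proof.
split; intros [l [_ H]]; exists l; (split; [apply is_linear_scal_l|exact H]).
Qed.

Lemma holo_at_continuous (f : C -> C) (z : C) : holo_at f z ->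
  forall eps, 0 < eps -> exists delta, 0 < delta /\
    forall w, Cmod (w - z)%C < delta -> Cmod (f w - f z)%C < eps.
Proof.
intros H eps He. apply holo_at_eps in H. destruct H as [l H].
destruct (H 1 Rlt_0_1) as [d [Hd0 Hd]].
assert (Hl := Cmod_ge_0 l).
exists (Rmin d (eps / (Cmod l + 2))); split.
{ apply Rmin_pos; [lra|]. apply Rdiv_lt_0_compat; lra. }
intros w Hw.
assert (Hw1 := Rlt_le_trans _ _ _ Hw (Rmin_l _ _)).
assert (Hw2 := Rlt_le_trans _ _ _ Hw (Rmin_r _ _)).
specialize (Hd w Hw1).
assert (Ht := Cmod_triangle (f w - f z - l * (w - z))%C (l * (w - z))%C).
replace (f w - f z - l * (w - z) + l * (w - z))%C with (f w - f z)%C in Ht by ring.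
rewrite Cmod_mult in Ht. assert (H0 := Cmod_ge_0 (w - z)%C).
apply Rle_lt_trans with ((Cmod l + 1) * Cmod (w - z)%C); [lra|].
apply Rle_lt_trans with ((Cmod l + 1) * (eps / (Cmod l + 2))).
{ apply Rmult_le_compat_l; lra. }
apply Rmult_lt_reg_r with (Cmod l + 2); [lra|].
replace ((Cmod l + 1) * (eps / (Cmod l + 2)) * (Cmod l + 2))
  with ((Cmod l + 1) * eps) by (field; lra).
nra.
Qed.

Lemma holo_at_ext_loc (f g : C -> C) (z : C) (r : R) : 0 < r ->
  (forall w, Cmod (w - z)%C < r -> f w = g w) -> holo_at f z -> holo_at g z.
Proof.
intros Hr H [l Hl]. exists l. revert Hl. apply is_derive_ext_loc.
exists (mkposreal r Hr). intros w Hw. apply H. exact Hw.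
Qed.

Lemma holo_at_const (c z : C) : holo_at (fun _ => c) z.
Proof. apply ex_derive_const. Qed.

Lemma holo_at_id (z : C) : holo_at (fun w => w) z.
Proof. apply ex_derive_id. Qed.

Lemma holo_at_plus (f g : C -> C) (z : C) :
  holo_at f z -> holo_at g z -> holo_at (fun w => f w + g w)%C z.
Proof.
intros [k Hk] [l Hl]. exists (plus k l).
exact (@is_derive_plus C_AbsRing (AbsRing_NormedModule C_AbsRing) f g z k l Hk Hl).
Qed.

Lemma holo_at_mult (f g : C -> C) (z : C) :
  holo_at f z -> holo_at g z -> holo_at (fun w => f w * g w)%C z.
Proof.
intros [k Hk] [l Hl]. eexists.
exact (@is_derive_mult C_AbsRing f g z k l Hk Hl Cmult_comm).
Qed.

Lemma holo_at_comp (f g : C -> C) (z : C) :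
  holo_at f (g z) -> holo_at g z -> holo_at (fun w => f (g w)) z.
Proof.
intros [k Hk] [l Hl]. eexists.
exact (@is_derive_comp C_AbsRing (AbsRing_NormedModule C_AbsRing) f g z k l Hk Hl).
Qed.

Lemma holo_at_scal (c : C) (f : C -> C) (z : C) :
  holo_at f z -> holo_at (fun w => c * f w)%C z.
Proof. apply holo_at_mult, holo_at_const. Qed.

Lemma holo_at_minus (f g : C -> C) (z : C) :
  holo_at f z -> holo_at g z -> holo_at (fun w => f w - g w)%C z.
Proof.
intros Hf Hg. apply holo_at_plus; [exact Hf|].
apply (holo_at_comp Copp g); [|exact Hg].
apply holo_at_eps. exists (-1)%C. intros eps He. exists 1; split; [lra|].
intros w _. replace (- w - - g z - -1 * (w - g z))%C with (RtoC 0) by ring.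
rewrite Cmod_0. apply Rmult_le_pos; [lra|apply Cmod_ge_0].
Qed.

Lemma holo_at_pow (f : C -> C) (z : C) (n : nat) :
  holo_at f z -> holo_at (fun w => Cpow (f w) n) z.
Proof.
intros Hf. induction n as [|n IH]; simpl.
- apply holo_at_const.
- apply holo_at_mult; assumption.
Qed.

Lemma holo_at_inv (f : C -> C) (z : C) :
  f z <> 0%C -> holo_at f z -> holo_at (fun w => / f w)%C z.
Proof.
intros Hz Hf. apply (holo_at_comp Cinv f); [|exact Hf].
set (a := f z) in *. apply holo_at_eps. exists (- / (a * a))%C.
intros eps He.
assert (Ha : 0 < Cmod a) by (apply Cmod_gt_0; exact Hz).
set (m := Cmod a) in *.
assert (Hm3 : 0 < m * m * m / 2).
{ repeat apply Rmult_lt_0_compat; lra. }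
(* Within m/2 of a one has |w| > m/2, so the remainder (w - a)^2 / (a^2 w) is at most 2 |w - a|^2 /
   m^3. *)
exists (Rmin (m / 2) (eps * (m * m * m / 2))); split.
{ apply Rmin_pos; [lra|]. apply Rmult_lt_0_compat; lra. }
intros w Hw.
assert (Hw1 := Rlt_le_trans _ _ _ Hw (Rmin_l _ _)).
assert (Hw2 := Rlt_le_trans _ _ _ Hw (Rmin_r _ _)).
assert (Hwm : m / 2 < Cmod w).
{ assert (Ht := Cmod_triangle w (- (w - a))%C). rewrite Cmod_opp in Ht.
  replace (w + - (w - a))%C with a in Ht by ring. fold m in Ht. lra. }
assert (Hw0 : w <> 0%C) by (apply Cmod_gt_0; lra).
replace (/ w - / a - - / (a * a) * (w - a))%C
  with ((w - a) * (w - a) * / (a * a * w))%C by (field; split; assumption).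
rewrite !Cmod_mult, Cmod_inv by (repeat apply Cmult_neq_0; assumption).
rewrite !Cmod_mult. fold m.
rewrite (Rmult_assoc (Cmod _)), (Rmult_comm (Cmod _)).
apply Rmult_le_compat_r; [apply Cmod_ge_0|].
assert (Hp : m * m * m / 2 <= m * m * Cmod w).
{ replace (m * m * m / 2) with (m * m * (m / 2)) by field.
  apply Rmult_le_compat_l; [|lra]. apply Rmult_le_pos; lra. }
apply Rle_div_l; [lra|].
apply Rle_trans with (eps * (m * m * m / 2)); [lra|].
apply Rmult_le_compat_l; lra.
Qed.

(** * The complex exponential *)

Definition Cexp (z : C) : C := (exp (Re z) * cos (Im z), exp (Re z) * sin (Im z)).

Lemma Cexp_plus (z w : C) : Cexp (z + w)%C = (Cexp z * Cexp w)%C.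
Proof.
unfold Cexp, Cmult, Cplus, Re, Im; simpl.
rewrite exp_plus, cos_plus, sin_plus. f_equal; ring.
Qed.

(** [Cexp] is, up to unfolding, the covering projection [proj] read in the chart. *)
Lemma Cmod_Cexp (z : C) : Cmod (Cexp z) = exp (Re z).
Proof. exact (Cmod_proj z). Qed.

Lemma Cexp_neq_0 (z : C) : Cexp z <> 0%C.
Proof. apply Cmod_gt_0. rewrite Cmod_Cexp. apply exp_pos. Qed.

Lemma Cmod_le_Rabs (z : C) : Cmod z <= Rabs (fst z) + Rabs (snd z).
Proof.
destruct z as [x y]. change (Cmod (x, y) <= Rabs x + Rabs y).
replace (x, y) with (RtoC x + Ci * RtoC y)%C
  by (unfold Cplus, Cmult, Ci, RtoC; simpl; f_equal; ring).
eapply Rle_trans; [apply Cmod_triangle|].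
rewrite Cmod_mult, Cmod_Ci, !Cmod_R. lra.
Qed.

Lemma Rabs_fst_le_Cmod (z : C) : Rabs (fst z) <= Cmod z.
Proof. eapply Rle_trans; [apply Rmax_l|apply Rmax_Cmod]. Qed.

Lemma Rabs_snd_le_Cmod (z : C) : Rabs (snd z) <= Cmod z.
Proof. eapply Rle_trans; [apply Rmax_r|apply Rmax_Cmod]. Qed.

Lemma derivable_pt_lim_remainder (f : R -> R) (l : R) : derivable_pt_lim f 0 l ->
  forall eps, 0 < eps -> exists delta, 0 < delta /\
    forall h, Rabs h < delta -> Rabs (f h - f 0 - l * h) <= eps * Rabs h.
Proof.
intros H eps He. destruct (H eps He) as [d Hd].
exists d; split; [apply cond_pos|]. intros h Hh.
destruct (Req_dec h 0) as [->|H0].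
- rewrite Rmult_0_r, Rminus_0_r, Rminus_diag, Rabs_R0. lra.
- specialize (Hd h H0 Hh). rewrite Rplus_0_l in Hd.
  replace (f h - f 0 - l * h) with (((f h - f 0) / h - l) * h) by (field; exact H0).
  rewrite Rabs_mult. apply Rmult_le_compat_r; [apply Rabs_pos|lra].
Qed.

Lemma Cexp_remainder (eps : R) : 0 < eps -> exists delta, 0 < delta /\
  forall h, Cmod h < delta -> Cmod (Cexp h - 1 - h)%C <= eps * Cmod h.
Proof.
intros He.
(* The estimates below use this share 1 + 3 + 3 + 2 = 9 times, so 16 leaves room. *)
assert (He' : 0 < eps / 16) by lra.
destruct (derivable_pt_lim_remainder _ _ (derivable_pt_lim_exp 0) _ He') as (d1 & Hd1 & H1).
destruct (derivable_pt_lim_remainder _ _ (derivable_pt_lim_cos 0) _ He') as (d2 & Hd2 & H2).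
destruct (derivable_pt_lim_remainder _ _ (derivable_pt_lim_sin 0) _ He') as (d3 & Hd3 & H3).
rewrite exp_0 in H1. rewrite sin_0, cos_0 in H2. rewrite cos_0, sin_0 in H3.
set (d := Rmin (Rmin d1 d2) (Rmin d3 (Rmin 1 (eps / 16)))).
assert (D1 := Rmin_l (Rmin d1 d2) (Rmin d3 (Rmin 1 (eps / 16)))).
assert (D2 := Rmin_r (Rmin d1 d2) (Rmin d3 (Rmin 1 (eps / 16)))).
fold d in D1, D2.
assert (D3 := Rmin_l d1 d2). assert (D4 := Rmin_r d1 d2).
assert (D5 := Rmin_l d3 (Rmin 1 (eps / 16))). assert (D6 := Rmin_r d3 (Rmin 1 (eps / 16))).
assert (D7 := Rmin_l 1 (eps / 16)). assert (D8 := Rmin_r 1 (eps / 16)).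
exists d; split.
{ unfold d. repeat apply Rmin_pos; lra. }
intros h Hh. eapply Rle_trans; [apply Cmod_le_Rabs|].
assert (Hx := Rabs_fst_le_Cmod h). assert (Hy := Rabs_snd_le_Cmod h).
set (m := Cmod h) in *. destruct h as [x y]. simpl in Hx, Hy.
unfold Cexp, Cminus, Cplus, Copp, Re, Im, RtoC; simpl.
specialize (H1 x ltac:(lra)). specialize (H2 y ltac:(lra)). specialize (H3 y ltac:(lra)).
assert (Hm : exp x <= 3).
{ eapply Rle_trans; [|exact exp_le_3].
  destruct (Rle_lt_or_eq_dec x 1) as [Hlt| ->]; [|left; apply exp_increasing, Hlt|right; reflexivity].
  apply Rle_trans with (Rabs x); [apply Rle_abs|lra]. }
assert (Hp := exp_pos x).
assert (Px := Rabs_pos x). assert (Py := Rabs_pos y).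
replace (exp x * cos y + - (1) + - x) with
  ((exp x - 1 - 1 * x) + exp x * (cos y - 1 - - 0 * y)) by ring.
replace (exp x * sin y + - 0 + - y) with
  (exp x * (sin y - 0 - 1 * y) + ((exp x - 1 - 1 * x) + x) * y) by ring.
set (a := exp x - 1 - 1 * x) in *. set (b := cos y - 1 - - 0 * y) in *.
set (c := sin y - 0 - 1 * y) in *.
assert (T1 := Rabs_triang a (exp x * b)).
assert (T2 := Rabs_triang (exp x * c) ((a + x) * y)).
assert (T3 := Rabs_triang a x).
rewrite (Rabs_mult (exp x)), (Rabs_pos_eq (exp x)) in T1 by lra.
rewrite (Rabs_mult (exp x)), (Rabs_mult (a + x)), (Rabs_pos_eq (exp x)) in T2 by lra.
assert (A1 : exp x * Rabs b <= 3 * (eps / 16 * Rabs y)).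
{ apply Rmult_le_compat; try lra; apply Rabs_pos. }
assert (A2 : exp x * Rabs c <= 3 * (eps / 16 * Rabs y)).
{ apply Rmult_le_compat; try lra; apply Rabs_pos. }
assert (A3 : Rabs (a + x) <= 2 * (eps / 16)) by nra.
assert (A4 : Rabs (a + x) * Rabs y <= 2 * (eps / 16) * Rabs y) by (apply Rmult_le_compat_r; lra).
assert (B1 : eps / 16 * Rabs x <= eps / 16 * m) by (apply Rmult_le_compat_l; lra).
assert (B2 : eps / 16 * Rabs y <= eps / 16 * m) by (apply Rmult_le_compat_l; lra).
assert (0 <= eps * m) by (apply Rmult_le_pos; lra).
lra.
Qed.

Lemma holo_at_Cexp (z : C) : holo_at Cexp z.
Proof.
apply holo_at_eps. exists (Cexp z). intros eps He.
assert (Hp := exp_pos (Re z)).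
destruct (Cexp_remainder (eps / exp (Re z))) as (d & Hd & H).
{ apply Rdiv_lt_0_compat; lra. }
exists d; split; [exact Hd|]. intros w Hw. specialize (H _ Hw).
set (h := (w - z)%C) in *.
replace w with (z + h)%C by (unfold h; ring). rewrite Cexp_plus.
replace (Cexp z * Cexp h - Cexp z - Cexp z * h)%C with (Cexp z * (Cexp h - 1 - h))%C by ring.
rewrite Cmod_mult, Cmod_Cexp.
apply Rle_trans with (exp (Re z) * (eps / exp (Re z) * Cmod h)).
{ apply Rmult_le_compat_l; lra. }
right. field. lra.
Qed.

(** * Bisection of rectangles and attained maxima *)

Lemma halving_limit (a b : nat -> R) :
  (forall n, a n <= a (S n) /\ b (S n) <= b n /\ a n <= b n /\
     b (S n) - a (S n) = (b n - a n) / 2) ->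
  exists x, (forall n, a n <= x <= b n) /\
    forall eps, 0 < eps -> exists n, b n - a n < eps.
Proof.
intros H.
assert (Ha : forall n m, a n <= a (n + m)%nat).
{ intros n m; induction m as [|m IH]; [rewrite Nat.add_0_r; lra|].
  rewrite Nat.add_succ_r. destruct (H (n + m)%nat). lra. }
assert (Hb : forall n m, b (n + m)%nat <= b n).
{ intros n m; induction m as [|m IH]; [rewrite Nat.add_0_r; lra|].
  rewrite Nat.add_succ_r. destruct (H (n + m)%nat). lra. }
assert (Hab : forall n m, a n <= b m).
{ intros n m. apply Rle_trans with (a (n + m)%nat); [apply Ha|].
  apply Rle_trans with (b (n + m)%nat); [apply H|].
  rewrite Nat.add_comm. apply Hb. }
destruct (completeness (fun t => exists n, t = a n)) as [x [Hx1 Hx2]].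
- exists (b 0%nat). intros t [n ->]. apply Hab.
- exists (a 0%nat), 0%nat. reflexivity.
- exists x; split.
  + intro n; split.
    * apply Hx1. exists n; reflexivity.
    * apply Hx2. intros t [m ->]. apply Hab.
  + intros eps He.
    assert (Hn : forall n, b n - a n = (b 0%nat - a 0%nat) * (1 / 2) ^ n).
    { intro n; induction n as [|n IH]; simpl; [ring|].
      destruct (H n) as (_ & _ & _ & ->). rewrite IH. field. }
    assert (H0 : 0 <= b 0%nat - a 0%nat) by (destruct (H 0%nat); lra).
    destruct (pow_lt_1_zero (1 / 2)) with (y := eps / (b 0%nat - a 0%nat + 1)) as [N HN].
    { rewrite Rabs_pos_eq; lra. }
    { apply Rdiv_lt_0_compat; lra. }
    exists N. specialize (HN N (le_n _)). rewrite Hn.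
    assert (Hp : 0 < (1 / 2) ^ N) by (apply pow_lt; lra).
    rewrite Rabs_pos_eq in HN by lra.
    apply Rlt_div_r in HN; [|lra]. nra.
Qed.

(** Otherwise every bad rectangle has a bad quarter, and nested bad quarters shrink to a point that
    contradicts the local hypothesis. This serves as the compactness argument both for attained
    maxima and for Goursat's theorem. *)
Lemma rectangle_cousin (P : R -> R -> R -> R -> Prop) (a0 b0 c0 d0 : R) :
  a0 <= b0 -> c0 <= d0 ->
  (forall a b c d, a <= b -> c <= d ->
    P a ((a + b) / 2) c ((c + d) / 2) -> P ((a + b) / 2) b c ((c + d) / 2) ->
    P a ((a + b) / 2) ((c + d) / 2) d -> P ((a + b) / 2) b ((c + d) / 2) d ->
    P a b c d) ->
  (forall x y, a0 <= x <= b0 -> c0 <= y <= d0 ->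
    exists delta, 0 < delta /\ forall a b c d,
      a0 <= a <= x -> x <= b <= b0 -> c0 <= c <= y -> y <= d <= d0 ->
      b - a < delta -> d - c < delta -> P a b c d) ->
  P a0 b0 c0 d0.
Proof.
intros Hab Hcd Hq Hloc. apply NNPP; intro Hnot.
set (bad := fun r : R * R * (R * R) =>
  ~ P (fst (fst r)) (snd (fst r)) (fst (snd r)) (snd (snd r))).
set (half := fun (r s : R * R * (R * R)) =>
  ((fst (fst s) = fst (fst r) /\ snd (fst s) = (fst (fst r) + snd (fst r)) / 2) \/
   (fst (fst s) = (fst (fst r) + snd (fst r)) / 2 /\ snd (fst s) = snd (fst r))) /\
  ((fst (snd s) = fst (snd r) /\ snd (snd s) = (fst (snd r) + snd (snd r)) / 2) \/
   (fst (snd s) = (fst (snd r) + snd (snd r)) / 2 /\ snd (snd s) = snd (snd r)))).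
set (ok := fun r : R * R * (R * R) => fst (fst r) <= snd (fst r) /\ fst (snd r) <= snd (snd r)).
(* The premises stand under the existential so that choice yields a total function [next], which can
   be iterated. *)
assert (Hstep : forall r, exists s, ok r -> bad r -> half r s /\ bad s).
{ intros [[a b] [c d]]. apply NNPP; intro Hn.
  assert (Hg : ok (a, b, (c, d)) /\ bad (a, b, (c, d)) /\
    forall s, half (a, b, (c, d)) s -> ~ bad s).
  { split; [|split].
    - apply NNPP; intro K. apply Hn. exists (a, b, (c, d)). tauto.
    - apply NNPP; intro K. apply Hn. exists (a, b, (c, d)). tauto.
    - intros s K K'. apply Hn. exists s. tauto. }
  destruct Hg as ([O1 O2] & K1 & K2). apply K1. simpl in *.
  apply Hq; try assumption.
  - apply NNPP; intro K. apply (K2 (a, (a + b) / 2, (c, (c + d) / 2))); [|exact K].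
    unfold half; simpl. tauto.
  - apply NNPP; intro K. apply (K2 ((a + b) / 2, b, (c, (c + d) / 2))); [|exact K].
    unfold half; simpl. tauto.
  - apply NNPP; intro K. apply (K2 (a, (a + b) / 2, ((c + d) / 2, d))); [|exact K].
    unfold half; simpl. tauto.
  - apply NNPP; intro K. apply (K2 ((a + b) / 2, b, ((c + d) / 2, d))); [|exact K].
    unfold half; simpl. tauto. }
pose (next := fun r => proj1_sig (constructive_indefinite_description _ (Hstep r))).
assert (Hnext : forall r, ok r -> bad r -> half r (next r) /\ bad (next r)).
{ intro r. unfold next. apply proj2_sig. }
pose (q := fun n => Nat.iter n next (a0, b0, (c0, d0))).
assert (Hinv : forall n, ok (q n) /\ bad (q n)).
{ induction n as [|n [IH1 IH2]]; simpl.
  - split; [split; assumption|exact Hnot].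
  - destruct (Hnext _ IH1 IH2) as [K1 K2]. fold (q n). split; [|exact K2].
    unfold ok. destruct IH1 as [O1 O2]. destruct K1 as [[[-> ->]|[-> ->]] [[-> ->]|[-> ->]]];
    split; lra. }
assert (Hhalf : forall n, half (q n) (q (S n))).
{ intro n. simpl. apply Hnext; apply Hinv. }
destruct (halving_limit (fun n => fst (fst (q n))) (fun n => snd (fst (q n)))) as (x & Hx & Hx').
{ intro n. destruct (Hinv n) as [[O1 O2] _].
  destruct (Hhalf n) as [[[-> ->]|[-> ->]] _]; lra. }
destruct (halving_limit (fun n => fst (snd (q n))) (fun n => snd (snd (q n)))) as (y & Hy & Hy').
{ intro n. destruct (Hinv n) as [[O1 O2] _].
  destruct (Hhalf n) as [_ [[-> ->]|[-> ->]]]; lra. }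
assert (Hmon : forall n m, fst (fst (q n)) <= fst (fst (q (n + m)%nat)) /\
  snd (fst (q (n + m)%nat)) <= snd (fst (q n)) /\
  fst (snd (q n)) <= fst (snd (q (n + m)%nat)) /\
  snd (snd (q (n + m)%nat)) <= snd (snd (q n))).
{ intros n m; induction m as [|m IH]; [rewrite Nat.add_0_r; lra|].
  rewrite Nat.add_succ_r. destruct (Hinv (n + m)%nat) as [[O1 O2] _].
  destruct (Hhalf (n + m)%nat) as [[[-> ->]|[-> ->]] [[-> ->]|[-> ->]]]; lra. }
assert (Q0 : forall n, a0 <= fst (fst (q n)) /\ snd (fst (q n)) <= b0 /\
  c0 <= fst (snd (q n)) /\ snd (snd (q n)) <= d0) by (intro n; exact (Hmon 0%nat n)).
destruct (Hloc x y) as (delta & Hd & HP).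
{ specialize (Hx 0%nat). exact Hx. }
{ specialize (Hy 0%nat). exact Hy. }
destruct (Hx' delta Hd) as [n1 N1]. destruct (Hy' delta Hd) as [n2 N2].
apply (proj2 (Hinv (n1 + n2)%nat)).
assert (M1 := Hmon n1 n2). assert (M2 := Hmon n2 n1). rewrite (Nat.add_comm n2 n1) in M2.
specialize (Hx (n1 + n2)%nat). specialize (Hy (n1 + n2)%nat). specialize (Q0 (n1 + n2)%nat).
simpl in *. apply HP; lra.
Qed.

(* If no maximum were attained, every point of [K] would have a neighbourhood on which
   [Phi] stays below one of its values; this property passes to finite unions. *)
Lemma usc_attains_max (K : C -> Prop) (Phi : C -> R) (r : R) (z0 : C) :
  (forall z, K z -> Cmod z <= r) ->
  (forall z, ~ K z -> exists delta, 0 < delta /\ forall w, Cmod (w - z)%C < delta -> ~ K w) ->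
  (forall z eps, K z -> 0 < eps -> exists delta, 0 < delta /\
     forall w, Cmod (w - z)%C < delta -> Phi w < Phi z + eps) ->
  K z0 -> exists a, K a /\ forall z, K z -> Phi z <= Phi a.
Proof.
intros Hr Hcl Husc Hz0. apply NNPP; intro Hno.
assert (Hbig : forall a, K a -> exists b, K b /\ Phi a < Phi b).
{ intros a Ha. apply NNPP; intro Hn. apply Hno. exists a; split; [exact Ha|].
  intros z Hz. apply Rnot_lt_le; intro Hlt. apply Hn. exists z; tauto. }
set (P := fun a b c d => exists m, K m /\
  forall z, K z -> a <= fst z <= b -> c <= snd z <= d -> Phi z < Phi m).
assert (HP : P (- r) r (- r) r).
{ assert (Hr0 : 0 <= r) by (apply Rle_trans with (1 := Cmod_ge_0 z0), Hr, Hz0).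
  apply rectangle_cousin; [lra|lra| |].
  - intros a b c d _ _ (m1 & K1 & H1) (m2 & K2 & H2) (m3 & K3 & H3) (m4 & K4 & H4).
    assert (Hmax : forall m m', K m -> K m' -> exists m'', K m'' /\ Phi m <= Phi m'' /\ Phi m' <= Phi m'').
    { intros m m' Hm Hm'. destruct (Rle_dec (Phi m) (Phi m')).
      - exists m'; repeat split; [assumption|lra|lra].
      - exists m; repeat split; [assumption|lra|lra]. }
    destruct (Hmax m1 m2 K1 K2) as (m5 & K5 & L1 & L2).
    destruct (Hmax m3 m4 K3 K4) as (m6 & K6 & L3 & L4).
    destruct (Hmax m5 m6 K5 K6) as (m & Km & L5 & L6).
    exists m; split; [exact Km|]. intros z Hz Hx Hy.
    destruct (Rle_dec (fst z) ((a + b) / 2)); destruct (Rle_dec (snd z) ((c + d) / 2)).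
    + specialize (H1 z Hz ltac:(lra) ltac:(lra)). lra.
    + specialize (H3 z Hz ltac:(lra) ltac:(lra)). lra.
    + specialize (H2 z Hz ltac:(lra) ltac:(lra)). lra.
    + specialize (H4 z Hz ltac:(lra) ltac:(lra)). lra.
  - intros x y Hx Hy.
    assert (Hnear : exists delta m, 0 < delta /\ K m /\
      forall w, Cmod (w - (x, y))%C < delta -> K w -> Phi w < Phi m).
    { destruct (classic (K (x, y))) as [Hk|Hk].
      - destruct (Hbig _ Hk) as (m & Hm & Hlt).
        destruct (Husc (x, y) (Phi m - Phi (x, y)) Hk ltac:(lra)) as (delta & Hd & H).
        exists delta, m. split; [exact Hd|]. split; [exact Hm|].
        intros w Hw _. specialize (H w Hw). lra.
      - destruct (Hcl _ Hk) as (delta & Hd & H). exists delta, z0.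
        split; [exact Hd|]. split; [exact Hz0|].
        intros w Hw Kw. exfalso. exact (H w Hw Kw). }
    destruct Hnear as (delta & m & Hd & Hm & H).
    exists (delta / 2); split; [lra|]. intros a b c d A1 A2 A3 A4 A5 A6.
    exists m; split; [exact Hm|]. intros z Hz B1 B2. apply H; [|exact Hz].
    eapply Rle_lt_trans; [apply Cmod_le_Rabs|]. simpl.
    assert (Rabs (fst z + - x) < delta / 2) by (apply Rabs_def1; lra).
    assert (Rabs (snd z + - y) < delta / 2) by (apply Rabs_def1; lra).
    lra. }
destruct HP as (m & Hm & H).
assert (Hmr := Hr m Hm).
assert (H1 := Rabs_fst_le_Cmod m). assert (H2 := Rabs_snd_le_Cmod m).
assert (Q1 := Rle_abs (fst m)). assert (Q2 := Rle_abs (- fst m)). rewrite Rabs_Ropp in Q2.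
assert (Q3 := Rle_abs (snd m)). assert (Q4 := Rle_abs (- snd m)). rewrite Rabs_Ropp in Q4.
apply (Rlt_irrefl (Phi m)), H; [exact Hm|lra|lra].
Qed.

(** * Goursat's theorem *)

Lemma Rabs_fst_minus_le (z w : C) : Rabs (fst z - fst w) <= Cmod (z - w)%C.
Proof. exact (Rabs_fst_le_Cmod (z - w)%C). Qed.

Lemma Rabs_snd_minus_le (z w : C) : Rabs (snd z - snd w) <= Cmod (z - w)%C.
Proof. exact (Rabs_snd_le_Cmod (z - w)%C). Qed.

(** [p] stands for the real or the imaginary part and [g] for a side of a rectangle; both are
    1-Lipschitz. *)
Lemma holo_at_continuous_path (F : C -> C) (g : R -> C) (p : C -> R) (t0 : R) :
  (forall z w, Rabs (p z - p w) <= Cmod (z - w)%C) ->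
  (forall t, Cmod (g t - g t0)%C <= Rabs (t - t0)) ->
  holo_at F (g t0) -> continuous (fun t => p (F (g t))) t0.
Proof.
intros Hp Hg HF P [eps HP].
destruct (holo_at_continuous F _ HF eps (cond_pos eps)) as (d & Hd & H).
exists (mkposreal d Hd). intros t Ht. apply HP.
unfold ball in *; simpl in *. unfold AbsRing_ball, abs, minus, plus, opp in *; simpl in *.
eapply Rle_lt_trans; [apply Hp|]. apply H.
eapply Rle_lt_trans; [apply Hg|]. exact Ht.
Qed.

Lemma Cmod_horizontal (t t0 y : R) : Cmod ((t, y) - (t0, y))%C <= Rabs (t - t0).
Proof.
eapply Rle_trans; [apply Cmod_le_Rabs|]. simpl.
rewrite Rplus_opp_r, Rabs_R0. unfold Rminus. lra.
Qed.

Lemma Cmod_vertical (t t0 x : R) : Cmod ((x, t) - (x, t0))%C <= Rabs (t - t0).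
Proof.
eapply Rle_trans; [apply Cmod_le_Rabs|]. simpl.
rewrite Rplus_opp_r, Rabs_R0. unfold Rminus. lra.
Qed.

Lemma RInt_near_const (g : R -> R) (a b k eta : R) : a <= b -> ex_RInt g a b ->
  (forall x, a <= x <= b -> Rabs (g x - k) <= eta) ->
  Rabs (RInt g a b - (b - a) * k) <= (b - a) * eta.
Proof.
intros Hab Hg H.
assert (H1 : RInt g a b <= (b - a) * (k + eta)).
{ replace ((b - a) * (k + eta)) with (RInt (fun _ => k + eta) a b) by (rewrite RInt_const; reflexivity).
  apply RInt_le; [exact Hab|exact Hg|apply ex_RInt_const|].
  intros x Hx. specialize (H x ltac:(lra)). apply Rabs_le_between in H. lra. }
assert (H2 : (b - a) * (k - eta) <= RInt g a b).
{ replace ((b - a) * (k - eta)) with (RInt (fun _ => k - eta) a b) by (rewrite RInt_const; reflexivity).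
  apply RInt_le; [exact Hab|apply ex_RInt_const|exact Hg|].
  intros x Hx. specialize (H x ltac:(lra)). apply Rabs_le_between in H. lra. }
apply Rabs_le_between. lra.
Qed.

(* The imaginary part of the integral of [F] along the boundary of a rectangle. *)
Definition boundary_integral (F : C -> C) (a b c d : R) : R :=
  RInt (fun x => snd (F (x, c))) a b - RInt (fun x => snd (F (x, d))) a b +
  (RInt (fun y => fst (F (b, y))) c d - RInt (fun y => fst (F (a, y))) c d).

Section Goursat.

Variables (F : C -> C) (a0 b0 c0 d0 : R).
Hypothesis (HF : forall x y, a0 <= x <= b0 -> c0 <= y <= d0 -> holo_at F (x, y)).

Lemma ex_RInt_horizontal (p : C -> R) (a b y : R) :
  (forall z w, Rabs (p z - p w) <= Cmod (z - w)%C) ->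
  a0 <= a <= b -> b <= b0 -> c0 <= y <= d0 -> ex_RInt (fun x => p (F (x, y))) a b.
Proof.
intros Hp Ha Hb Hy. apply (ex_RInt_continuous (V := R_CompleteNormedModule)).
rewrite Rmin_left, Rmax_right by lra. intros x Hx.
apply (holo_at_continuous_path F (fun x => (x, y))); [exact Hp| |apply HF; lra].
intro t. apply Cmod_horizontal.
Qed.

Lemma ex_RInt_vertical (p : C -> R) (c d x : R) :
  (forall z w, Rabs (p z - p w) <= Cmod (z - w)%C) ->
  c0 <= c <= d -> d <= d0 -> a0 <= x <= b0 -> ex_RInt (fun y => p (F (x, y))) c d.
Proof.
intros Hp Hc Hd Hx. apply (ex_RInt_continuous (V := R_CompleteNormedModule)).
rewrite Rmin_left, Rmax_right by lra. intros y Hy.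
apply (holo_at_continuous_path F (fun y => (x, y))); [exact Hp| |apply HF; lra].
intro t. apply Cmod_vertical.
Qed.

(** Each inner side occurs twice with opposite signs. *)
Lemma boundary_integral_quarters (a m b c n d : R) :
  a0 <= a <= m -> m <= b <= b0 -> c0 <= c <= n -> n <= d <= d0 ->
  boundary_integral F a b c d =
  boundary_integral F a m c n + boundary_integral F m b c n +
  boundary_integral F a m n d + boundary_integral F m b n d.
Proof.
intros Ha Hb Hc Hd.
assert (Hh : forall y, c0 <= y <= d0 -> RInt (fun x => snd (F (x, y))) a b =
  RInt (fun x => snd (F (x, y))) a m + RInt (fun x => snd (F (x, y))) m b).
{ intros y Hy. symmetry. apply (RInt_Chasles (fun x => snd (F (x, y))));
  apply ex_RInt_horizontal; try exact Rabs_snd_minus_le; lra. }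
assert (Hv : forall x, a0 <= x <= b0 -> RInt (fun y => fst (F (x, y))) c d =
  RInt (fun y => fst (F (x, y))) c n + RInt (fun y => fst (F (x, y))) n d).
{ intros x Hx. symmetry. apply (RInt_Chasles (fun y => fst (F (x, y))));
  apply ex_RInt_vertical; try exact Rabs_fst_minus_le; lra. }
unfold boundary_integral.
rewrite (Hh c), (Hh d), (Hv a), (Hv b) by lra. ring.
Qed.

(** The affine part of F at the point contributes minus and plus [l1] times the area, which cancel.
    The remainder is at most eps/2 times the half-perimeter s, so differences across opposite sides
    err by at most eps s, and integrating them over lengths of total s gives eps s^2. *)
Lemma boundary_integral_local (x0 y0 eps : R) :
  a0 <= x0 <= b0 -> c0 <= y0 <= d0 -> 0 < eps ->
  exists delta, 0 < delta /\ forall a b c d,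
    a0 <= a <= x0 -> x0 <= b <= b0 -> c0 <= c <= y0 -> y0 <= d <= d0 ->
    b - a < delta -> d - c < delta ->
    Rabs (boundary_integral F a b c d) <= eps * (b - a + (d - c)) ^ 2.
Proof.
intros Hx0 Hy0 He.
assert (H := HF x0 y0 Hx0 Hy0). apply holo_at_eps in H. destruct H as [[l1 l2] H].
destruct (H (eps / 2) ltac:(lra)) as (delta & Hd & Hnear). clear H.
exists (delta / 2); split; [lra|]. intros a b c d A1 A2 A3 A4 A5 A6.
set (s := b - a + (d - c)).
assert (Hpt : forall x y, a <= x <= b -> c <= y <= d ->
  Rabs (fst (F (x, y)) - fst (F (x0, y0)) - (l1 * (x - x0) - l2 * (y - y0))) <= eps / 2 * s /\
  Rabs (snd (F (x, y)) - snd (F (x0, y0)) - (l1 * (y - y0) + l2 * (x - x0))) <= eps / 2 * s).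
{ intros x y Hx Hy.
  assert (Hm : Cmod ((x, y) - (x0, y0))%C <= s).
  { eapply Rle_trans; [apply Cmod_le_Rabs|]. simpl. unfold s.
    apply Rplus_le_compat; apply Rabs_le; lra. }
  assert (K := Hnear (x, y) ltac:(unfold s in Hm; lra)).
  assert (K' : Cmod (F (x, y) - F (x0, y0) - (l1, l2) * ((x, y) - (x0, y0)))%C <= eps / 2 * s).
  { eapply Rle_trans; [exact K|]. apply Rmult_le_compat_l; lra. }
  split.
  - eapply Rle_trans; [|exact K']. eapply Rle_trans; [|apply Rabs_fst_le_Cmod].
    apply Req_le, (f_equal Rabs). simpl. ring.
  - eapply Rle_trans; [|exact K']. eapply Rle_trans; [|apply Rabs_snd_le_Cmod].
    apply Req_le, (f_equal Rabs). simpl. ring. }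
unfold boundary_integral.
assert (E1 : RInt (fun x => snd (F (x, c))) a b - RInt (fun x => snd (F (x, d))) a b =
  RInt (fun x => snd (F (x, c)) - snd (F (x, d))) a b).
{ symmetry. apply (RInt_minus (fun x => snd (F (x, c))) (fun x => snd (F (x, d))));
  apply ex_RInt_horizontal; try exact Rabs_snd_minus_le; lra. }
assert (E2 : RInt (fun y => fst (F (b, y))) c d - RInt (fun y => fst (F (a, y))) c d =
  RInt (fun y => fst (F (b, y)) - fst (F (a, y))) c d).
{ symmetry. apply (RInt_minus (fun y => fst (F (b, y))) (fun y => fst (F (a, y))));
  apply ex_RInt_vertical; try exact Rabs_fst_minus_le; lra. }
rewrite E1, E2.
assert (B1 : Rabs (RInt (fun x => snd (F (x, c)) - snd (F (x, d))) a b - (b - a) * (- l1 * (d - c)))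
  <= (b - a) * (eps * s)).
{ apply RInt_near_const; [lra| |].
  - apply (ex_RInt_minus (V := R_NormedModule)); apply ex_RInt_horizontal; try exact Rabs_snd_minus_le; lra.
  - intros x Hx. destruct (Hpt x c) as [_ K1]; [lra|lra|]. destruct (Hpt x d) as [_ K2]; [lra|lra|].
    apply Rabs_le_between in K1. apply Rabs_le_between in K2. apply Rabs_le_between. lra. }
assert (B2 : Rabs (RInt (fun y => fst (F (b, y)) - fst (F (a, y))) c d - (d - c) * (l1 * (b - a)))
  <= (d - c) * (eps * s)).
{ apply RInt_near_const; [lra| |].
  - apply (ex_RInt_minus (V := R_NormedModule)); apply ex_RInt_vertical; try exact Rabs_fst_minus_le; lra.
  - intros y Hy. destruct (Hpt b y) as [K1 _]; [lra|lra|]. destruct (Hpt a y) as [K2 _]; [lra|lra|].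
    apply Rabs_le_between in K1. apply Rabs_le_between in K2. apply Rabs_le_between. lra. }
apply Rabs_le_between in B1. apply Rabs_le_between in B2. apply Rabs_le_between.
replace (eps * s ^ 2) with ((b - a) * (eps * s) + (d - c) * (eps * s)) by (unfold s; ring).
lra.
Qed.

Lemma goursat : a0 <= b0 -> c0 <= d0 -> boundary_integral F a0 b0 c0 d0 = 0.
Proof.
intros Hab Hcd.
set (s := (b0 - a0 + (d0 - c0)) ^ 2).
assert (Hs : 0 <= s) by apply pow2_ge_0.
assert (H : forall eps, 0 < eps -> Rabs (boundary_integral F a0 b0 c0 d0) <= eps * s).
{ intros eps He.
  cut (a0 <= a0 -> b0 <= b0 -> c0 <= c0 -> d0 <= d0 ->
    Rabs (boundary_integral F a0 b0 c0 d0) <= eps * (b0 - a0 + (d0 - c0)) ^ 2).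
  { intro K. apply K; lra. }
  (* Quartering halves the half-perimeter, and four bounds eps (s/2)^2 add up to eps s^2, so this
     form of the estimate passes from the quarters to the whole. *)
  apply (rectangle_cousin (fun a b c d => a0 <= a -> b <= b0 -> c0 <= c -> d <= d0 ->
    Rabs (boundary_integral F a b c d) <= eps * (b - a + (d - c)) ^ 2)); [exact Hab|exact Hcd| |].
  - intros a b c d Ha Hc H1 H2 H3 H4 A1 A2 A3 A4.
    rewrite (boundary_integral_quarters a ((a + b) / 2) b c ((c + d) / 2) d) by lra.
    specialize (H1 ltac:(lra) ltac:(lra) ltac:(lra) ltac:(lra)).
    specialize (H2 ltac:(lra) ltac:(lra) ltac:(lra) ltac:(lra)).
    specialize (H3 ltac:(lra) ltac:(lra) ltac:(lra) ltac:(lra)).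
    specialize (H4 ltac:(lra) ltac:(lra) ltac:(lra) ltac:(lra)).
    apply Rabs_le_between in H1. apply Rabs_le_between in H2.
    apply Rabs_le_between in H3. apply Rabs_le_between in H4.
    apply Rabs_le_between. lra.
  - intros x y Hx Hy. destruct (boundary_integral_local x y eps Hx Hy He) as (delta & Hd & K).
    exists delta; split; [exact Hd|]. intros a b c d A1 A2 A3 A4 A5 A6 _ _ _ _.
    apply K; assumption. }
destruct (Req_dec (boundary_integral F a0 b0 c0 d0) 0) as [E|E]; [exact E|].
apply Rabs_pos_lt in E. set (j := Rabs (boundary_integral F a0 b0 c0 d0)) in *.
specialize (H (j / (2 * (s + 1)))).
assert (0 < j / (2 * (s + 1))) by (apply Rdiv_lt_0_compat; lra).
specialize (H H0).
assert (j / (2 * (s + 1)) * s <= j / (2 * (s + 1)) * (s + 1)) by (apply Rmult_le_compat_l; lra).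
replace (j / (2 * (s + 1)) * (s + 1)) with (j / 2) in H1 by (field; lra). lra.
Qed.

End Goursat.

(** * The maximum principle *)

(* In the chart w = a + exp s, circles around a become vertical segments, and Goursat
   says that the mean of F over such a circle does not depend on its radius. *)
Lemma no_strict_real_part_max (F : C -> C) (a : C) (rho eta : R) :
  0 < rho -> 0 < eta -> (forall w, Cmod (w - a)%C < rho -> holo_at F w) ->
  ~ (forall w, Cmod (w - a)%C < rho -> fst (F w) <= fst (F a) - eta * Cmod (w - a)%C ^ 2).
Proof.
intros Hrho Heta HF Hmax. assert (HPI := PI_RGT_0).
set (r := rho / 2). assert (Hr : 0 < r) by (unfold r; lra).
(* On the circle of radius r the real part is at most its value at a minus 2e; on a tiny circle
   continuity keeps it above that value minus e. Equal means are then impossible. *)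
set (e := eta * r ^ 2 / 2).
assert (He : 0 < e).
{ unfold e. apply Rdiv_lt_0_compat; [|lra]. apply Rmult_lt_0_compat; [lra|]. apply pow_lt; lra. }
destruct (holo_at_continuous F a (HF a ltac:(unfold Cminus; rewrite Cplus_opp_r, Cmod_0; lra)) e He) as (d & Hd & Hcont).
set (x2 := ln r). set (x1 := Rmin x2 (ln (d / 2))).
set (Psi := fun s => F (a + Cexp s)%C).
assert (Hsub : forall s, Cmod (a + Cexp s - a)%C = exp (Re s)).
{ intro s. replace (a + Cexp s - a)%C with (Cexp s) by ring. apply Cmod_Cexp. }
assert (Hx1 : exp x1 < d /\ x1 <= x2).
{ split; [|apply Rmin_l]. apply Rle_lt_trans with (d / 2); [|lra].
  rewrite <- (exp_ln (d / 2)) by lra. assert (K := Rmin_r x2 (ln (d / 2))). fold x1 in K.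
  destruct K as [K|K]; [left; apply exp_increasing, K|right; rewrite K; reflexivity]. }
destruct Hx1 as [Hx1 Hx12].
assert (Hx2 : exp x2 = r) by (apply exp_ln; lra).
assert (Hle : forall x, x <= x2 -> exp x <= r).
{ intros x [K|K]; rewrite <- Hx2; [left; apply exp_increasing, K|right; rewrite K; reflexivity]. }
assert (HPsi : forall x y, x1 <= x <= x2 -> 0 <= y <= 2 * PI -> holo_at Psi (x, y)).
{ intros x y Hx _. unfold Psi. apply (holo_at_comp F (fun s => a + Cexp s)%C).
  - apply HF. rewrite Hsub. apply Rle_lt_trans with r; [apply Hle; simpl; lra|unfold r; lra].
  - apply holo_at_plus; [apply holo_at_const|apply holo_at_Cexp]. }
assert (Hg := goursat Psi x1 x2 0 (2 * PI) HPsi Hx12 ltac:(lra)).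
unfold boundary_integral in Hg.
(* By periodicity the horizontal sides cancel, and the two vertical integrals, 2 pi times the means
   on the two circles, are equal. *)
rewrite (RInt_ext (fun x => snd (Psi (x, 2 * PI))) (fun x => snd (Psi (x, 0)))) in Hg.
2:{ intros x _. unfold Psi, Cexp; simpl. rewrite sin_2PI, cos_2PI, sin_0, cos_0. reflexivity. }
assert (Hup : RInt (fun y => fst (Psi (x2, y))) 0 (2 * PI) <= 2 * PI * (fst (F a) - 2 * e)).
{ replace (2 * PI * (fst (F a) - 2 * e)) with (RInt (fun _ => fst (F a) - 2 * e) 0 (2 * PI))
    by (rewrite RInt_const; unfold scal; simpl; unfold mult; simpl; ring).
  apply RInt_le; [lra| |apply ex_RInt_const|].
  - apply (ex_RInt_vertical Psi x1 x2 0 (2 * PI)); try exact Rabs_fst_minus_le; try assumption; lra.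
  - intros y _. unfold Psi. eapply Rle_trans; [apply Hmax|].
    + rewrite Hsub. simpl. rewrite Hx2. unfold r; lra.
    + rewrite Hsub. simpl Re. rewrite Hx2. unfold e. lra. }
assert (Hlow : 2 * PI * (fst (F a) - e) <= RInt (fun y => fst (Psi (x1, y))) 0 (2 * PI)).
{ replace (2 * PI * (fst (F a) - e)) with (RInt (fun _ => fst (F a) - e) 0 (2 * PI))
    by (rewrite RInt_const; unfold scal; simpl; unfold mult; simpl; ring).
  apply RInt_le; [lra|apply ex_RInt_const| |].
  - apply (ex_RInt_vertical Psi x1 x2 0 (2 * PI)); try exact Rabs_fst_minus_le; try assumption; lra.
  - intros y _. unfold Psi.
    assert (K := Hcont (a + Cexp (x1, y))%C). rewrite Hsub in K. specialize (K Hx1).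
    assert (K' := Rabs_fst_minus_le (F (a + Cexp (x1, y))%C) (F a)).
    assert (K2 : Rabs (fst (F (a + Cexp (x1, y))%C) - fst (F a)) <= e) by lra.
    apply Rabs_le_between in K2. lra. }
assert (K : 2 * PI * (fst (F a) - e) <= 2 * PI * (fst (F a) - 2 * e)) by lra.
apply Rmult_le_reg_l in K; lra.
Qed.

Lemma exists_unit_rotation (z : C) : exists u : C, Cmod u = 1 /\ (u * z)%C = RtoC (Cmod z).
Proof.
destruct (Req_dec (Cmod z) 0) as [E|E].
- exists 1%C. rewrite E. apply Cmod_eq_0 in E. subst z.
  rewrite Cmod_1. split; [reflexivity|ring].
- assert (Hz : RtoC (Cmod z) <> 0%C) by (intro K; apply E; injection K; tauto).
  exists (Cconj z / Cmod z)%C. rewrite Cmod_div by exact Hz.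
  rewrite Cmod_conj, Cmod_R, Rabs_pos_eq by apply Cmod_ge_0.
  split; [field; exact E|].
  replace (Cconj z / Cmod z * z)%C with ((z * Cconj z) / Cmod z)%C by (field; exact Hz).
  rewrite <- Cmod2_conj. rewrite RtoC_pow. simpl. field. exact Hz.
Qed.

(* At an interior maximum [a] of [|F| + eta |z|^2], the real part of
   [u F + 2 eta conj(a) z], with [u F(a) = |F(a)|], would have a strict maximum. *)
Lemma max_modulus (K : C -> Prop) (F : C -> C) (r B : R) :
  (forall z, K z -> Cmod z <= r) ->
  (forall z, ~ K z -> exists delta, 0 < delta /\ forall w, Cmod (w - z)%C < delta -> ~ K w) ->
  (forall z, K z -> holo_at F z) ->
  (forall z, K z -> Cmod (F z) <= B \/
     exists rho, 0 < rho /\ forall w, Cmod (w - z)%C < rho -> K w) ->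
  forall z, K z -> Cmod (F z) <= B.
Proof.
intros Hr Hcl HF Hbd.
assert (Heta : forall eta, 0 < eta -> forall z, K z -> Cmod (F z) <= B + eta * r ^ 2).
{ intros eta He z Hz.
  set (Phi := fun z => Cmod (F z) + eta * Cmod z ^ 2).
  destruct (usc_attains_max K Phi r z Hr Hcl) as (a & Ha & Hmax); [|exact Hz|].
  { intros z1 eps Hz1 Heps. unfold Phi.
    assert (Hr0 := Rle_trans _ _ _ (Cmod_ge_0 z1) (Hr z1 Hz1)).
    destruct (holo_at_continuous F z1 (HF z1 Hz1) (eps / 2) ltac:(lra)) as (d & Hd & Hc).
    set (k := eta * (2 * r + 1) * 2). assert (Hk : 0 < k).
    { unfold k. repeat apply Rmult_lt_0_compat; lra. }
    exists (Rmin d (Rmin 1 (eps / k))). split.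
    { repeat apply Rmin_pos; try lra. apply Rdiv_lt_0_compat; lra. }
    intros w Hw.
    assert (Hw1 := Rlt_le_trans _ _ _ Hw (Rmin_l _ _)).
    assert (Hw2 := Rlt_le_trans _ _ _ Hw (Rmin_r _ _)).
    assert (Hw3 := Rlt_le_trans _ _ _ Hw2 (Rmin_l _ _)).
    assert (Hw4 := Rlt_le_trans _ _ _ Hw2 (Rmin_r _ _)).
    specialize (Hc w Hw1).
    assert (T1 := Cmod_triangle (F w - F z1)%C (F z1)).
    replace (F w - F z1 + F z1)%C with (F w) in T1 by ring.
    assert (T2 := Cmod_triangle (w - z1)%C z1).
    replace (w - z1 + z1)%C with w in T2 by ring.
    assert (Hzr := Hr z1 Hz1). assert (P1 := Cmod_ge_0 z1). assert (P2 := Cmod_ge_0 w).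
    assert (P3 := Cmod_ge_0 (w - z1)%C).
    set (t := Cmod (w - z1)%C) in *.
    apply Rlt_div_r in Hw4; [|exact Hk]. unfold k in Hw4.
    assert (Cmod w ^ 2 <= (t + Cmod z1) ^ 2) by (apply pow_incr; lra).
    assert ((t + Cmod z1) ^ 2 <= Cmod z1 ^ 2 + t * (2 * r + 1)) by nra.
    assert (eta * Cmod w ^ 2 <= eta * (Cmod z1 ^ 2 + t * (2 * r + 1))) by (apply Rmult_le_compat_l; lra).
    lra. }
  assert (Hfa : Cmod (F a) <= B).
  { destruct (Hbd a Ha) as [H|(rho & Hrho & Hint)]; [exact H|exfalso].
    destruct (exists_unit_rotation (F a)) as (u & Hu & HuF).
    (* The linear term completes the square: |w|^2 - 2 Re (conj(a) w) + |a|^2 = |w - a|^2, so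
       maximality of [Phi] at a becomes the quadratic drop required here. *)
    apply (no_strict_real_part_max (fun w => u * F w + (2 * eta)%R * Cconj a * w)%C a rho eta); try assumption.
    - intros w Hw. apply holo_at_plus.
      + apply holo_at_scal, HF, Hint, Hw.
      + apply holo_at_scal, holo_at_id.
    - intros w Hw. specialize (Hmax w (Hint w Hw)). unfold Phi in Hmax.
      assert (H1 : fst (u * F w)%C <= Cmod (F w)).
      { eapply Rle_trans; [apply Rle_abs|]. eapply Rle_trans; [apply Rabs_fst_le_Cmod|].
        rewrite Cmod_mult, Hu. lra. }
      change (fst (u * F w)%C + fst ((2 * eta)%R * Cconj a * w)%C <=
        fst (u * F a)%C + fst ((2 * eta)%R * Cconj a * a)%C - eta * Cmod (w - a)%C ^ 2).
      rewrite HuF. change (fst (RtoC (Cmod (F a)))) with (Cmod (F a)).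
      rewrite (Cmod2_alt (w - a)%C). rewrite (Cmod2_alt a), (Cmod2_alt w) in Hmax.
      destruct a as [a1 a2], w as [w1 w2].
      unfold Re, Im in *. simpl in *. lra. }
  specialize (Hmax z Hz). unfold Phi in Hmax.
  assert (Cmod a ^ 2 <= r ^ 2) by (apply pow_incr; split; [apply Cmod_ge_0|apply Hr, Ha]).
  assert (0 <= Cmod z ^ 2) by apply pow2_ge_0.
  assert (eta * Cmod a ^ 2 <= eta * r ^ 2) by (apply Rmult_le_compat_l; lra).
  assert (0 <= eta * Cmod z ^ 2) by (apply Rmult_le_pos; lra).
  lra. }
intros z Hz.
apply (affine_bound (Cmod (F z)) B (r ^ 2) 1); [lra|apply pow2_ge_0|].
intros t Ht. rewrite (Rmult_comm (r ^ 2)). apply Heta; [lra|exact Hz].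
Qed.

(** * The identity theorem *)

Lemma le_geometric_eq_0 (x B q : R) : 0 <= x -> 0 <= q < 1 ->
  (forall n, x <= B * q ^ n) -> x = 0.
Proof.
intros Hx Hq H. destruct (Req_dec x 0) as [E|E]; [exact E|exfalso].
assert (HB : 0 < B) by (specialize (H 0%nat); simpl in H; lra).
destruct (pow_lt_1_zero q) with (y := x / B) as [N HN].
{ rewrite Rabs_pos_eq; lra. }
{ apply Rdiv_lt_0_compat; lra. }
specialize (HN N (le_n _)). specialize (H N).
rewrite Rabs_pos_eq in HN by (apply pow_le; lra).
apply Rlt_div_r in HN; lra.
Qed.

Lemma Cmod_minus_le (z w : C) : Cmod z <= Cmod (z - w)%C + Cmod w.
Proof.
replace z with ((z - w) + w)%C at 1 by ring. apply Cmod_triangle.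
Qed.

Lemma Cmod_dist_triangle (x y z : C) : Cmod (x - z)%C <= Cmod (x - y)%C + Cmod (y - z)%C.
Proof.
replace (x - z)%C with ((x - y) + (y - z))%C by ring. apply Cmod_triangle.
Qed.

Lemma Cmod_dist_sym (x y : C) : Cmod (x - y)%C = Cmod (y - x)%C.
Proof.
rewrite <- (Cmod_opp (x - y)%C). f_equal. ring.
Qed.

(* Compare [h] on an annulus with the powers of [w - c], as in Hadamard's three circles theorem. *)
Lemma zero_on_disc (h : C -> C) (c : C) (r R : R) : 0 < r ->
  (forall w, Cmod (w - c)%C < R -> holo_at h w) ->
  (forall w, Cmod (w - c)%C < r -> h w = 0%C) ->
  forall z, Cmod (z - c)%C < R -> h z = 0%C.
Proof.
intros Hr Hh H0 z Hz. set (t := Cmod (z - c)%C) in *.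
destruct (Rlt_le_dec t r) as [Htr|Htr]; [apply H0, Htr|].
set (R' := (t + R) / 2). assert (HR' : t < R' < R) by (unfold R'; lra).
(* The inner boundary lies inside the disc where h vanishes, so only the outer circle matters in the
   maximum principle. *)
set (K := fun w => r / 2 <= Cmod (w - c)%C <= R').
assert (HKb : forall w, K w -> Cmod w <= R' + Cmod c).
{ intros w [_ Hw]. assert (T := Cmod_minus_le w c). lra. }
assert (HKc : forall w, ~ K w -> exists delta, 0 < delta /\
  forall v, Cmod (v - w)%C < delta -> ~ K v).
{ intros w Hw. destruct (Rlt_le_dec (Cmod (w - c)%C) (r / 2)) as [H1|H1].
  - exists (r / 2 - Cmod (w - c)%C); split; [lra|]. intros v Hv [K1 _].
    assert (T := Cmod_dist_triangle v w c). lra.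
  - destruct (Rle_lt_dec (Cmod (w - c)%C) R') as [H2|H2]; [exfalso; apply Hw; split; lra|].
    exists (Cmod (w - c)%C - R'); split; [lra|]. intros v Hv [_ K2].
    assert (T := Cmod_dist_triangle w v c). rewrite (Cmod_dist_sym w v) in T. lra. }
assert (HKz : K z) by (unfold K; fold t; lra).
destruct (usc_attains_max K (fun w => Cmod (h w)) (R' + Cmod c) z HKb HKc) as (a & Ha & Hmax);
  [|exact HKz|].
{ intros w eps [_ Hw] He.
  destruct (holo_at_continuous h w (Hh w ltac:(lra)) eps He) as (d & Hd & Hc).
  exists d; split; [exact Hd|]. intros v Hv. specialize (Hc v Hv).
  assert (T := Cmod_minus_le (h v) (h w)). lra. }
apply Cmod_eq_0.
apply (le_geometric_eq_0 _ (Cmod (h a)) (t / R')); [apply Cmod_ge_0| |].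
{ split; [apply Rle_mult_inv_pos; lra|]. apply Rlt_div_l; lra. }
intro n.
(* This says |h(z)| <= |h(a)| (t/R')^n; as t < R', letting n grow forces h(z) = 0. *)
assert (HF : Cmod (h z * Cpow (/ (z - c)) n)%C <= Cmod (h a) * (/ R') ^ n).
{ apply (max_modulus K (fun w => h w * Cpow (/ (w - c)) n)%C (R' + Cmod c)); try assumption.
  - intros w [K1 K2]. apply holo_at_mult; [apply Hh; lra|]. apply holo_at_pow.
    apply (holo_at_inv (fun w => (w - c)%C)).
    + apply Cmod_gt_0. lra.
    + apply holo_at_minus; [apply holo_at_id|apply holo_at_const].
  - intros w Hw. destruct (Rlt_le_dec (Cmod (w - c)%C) r) as [H1|H1].
    { left. rewrite (H0 w H1), Cmult_0_l, Cmod_0.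
      apply Rmult_le_pos; [apply Cmod_ge_0|]. apply pow_le. left. apply Rinv_0_lt_compat. lra. }
    destruct (Rlt_le_dec (Cmod (w - c)%C) R') as [H2|H2].
    + right. exists (Rmin (r / 2) (R' - Cmod (w - c)%C)). split; [apply Rmin_pos; lra|].
      intros v Hv. assert (Q1 := Rmin_l (r / 2) (R' - Cmod (w - c)%C)).
      assert (Q2 := Rmin_r (r / 2) (R' - Cmod (w - c)%C)).
      assert (T1 := Cmod_dist_triangle v w c). assert (T2 := Cmod_dist_triangle w v c).
      rewrite (Cmod_dist_sym w v) in T2. split; lra.
    + left. assert (E : Cmod (w - c)%C = R') by (destruct Hw; lra).
      rewrite Cmod_mult, Cmod_pow, Cmod_inv by (apply Cmod_gt_0; lra). rewrite E.
      apply Rmult_le_compat_r; [|apply Hmax, Hw].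
      apply pow_le. left. apply Rinv_0_lt_compat. lra. }
rewrite Cmod_mult, Cmod_pow, Cmod_inv in HF by (apply Cmod_gt_0; fold t; lra).
fold t in HF.
assert (Ht : 0 < t ^ n) by (apply pow_lt; lra).
apply (Rmult_le_reg_r ((/ t) ^ n)); [apply pow_lt, Rinv_0_lt_compat; lra|].
eapply Rle_trans; [exact HF|]. right.
rewrite Rmult_assoc, <- Rpow_mult_distr. do 2 f_equal. field. lra.
Qed.

(** Neighbourhoods in the chart are boxes; this lemma and the next one exchange them for discs. *)
Lemma open_Cmod_ball (G : LogSurface -> Prop) (z : C) : open G -> G z ->
  exists r, 0 < r /\ forall w, Cmod (w - z)%C < r -> G w.
Proof.
intros HG Hz. destruct (HG z Hz) as [eps H]. exists eps; split; [apply cond_pos|].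
intros w Hw. apply H. split; simpl; unfold AbsRing_ball, abs, minus, plus, opp; simpl.
- eapply Rle_lt_trans; [apply Rabs_fst_minus_le|exact Hw].
- eapply Rle_lt_trans; [apply Rabs_snd_minus_le|exact Hw].
Qed.

Lemma Cmod_ball_open (U : LogSurface -> Prop) :
  (forall z, U z -> exists r, 0 < r /\ forall w, Cmod (w - z)%C < r -> U w) -> open U.
Proof.
intros H z Hz. destruct (H z Hz) as (r & Hr & K).
assert (Hr2 : 0 < r / 2) by lra.
exists (mkposreal _ Hr2). intros w [B1 B2]. apply K.
change (Rabs (fst w - fst z) < r / 2) in B1. change (Rabs (snd w - snd z) < r / 2) in B2.
eapply Rle_lt_trans; [apply Cmod_le_Rabs|]. simpl. unfold Rminus in *. lra.
Qed.

(** Let N be the interior of the zero set. Its part in G is open, the rest of G is open by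
    [zero_on_disc], and connectedness excludes that both are inhabited. *)
Lemma identity_theorem (G : LogSurface -> Prop) (h : C -> C) (z0 : C) (r0 : R) :
  open G -> connected G -> (forall z, G z -> holo_at h z) ->
  G z0 -> 0 < r0 -> (forall w, Cmod (w - z0)%C < r0 -> h w = 0%C) ->
  forall z, G z -> h z = 0%C.
Proof.
intros Hop Hcon Hh Hz0 Hr0 H0 z Hz.
set (N := fun z : C => exists r, 0 < r /\ forall w, Cmod (w - z)%C < r -> h w = 0%C).
apply NNPP; intro Hne.
destruct (Hcon (fun z => G z /\ N z) (fun z => G z /\ ~ N z)) as (x & _ & [_ HN] & [_ HN']).
- apply Cmod_ball_open. intros x [HGx (r & Hr & Hx)].
  destruct (open_Cmod_ball G x Hop HGx) as (rho & Hrho & HGr).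
  exists (Rmin rho r); split; [apply Rmin_pos; lra|]. intros w Hw.
  assert (Q1 := Rmin_l rho r). assert (Q2 := Rmin_r rho r). split; [apply HGr; lra|].
  exists (r - Cmod (w - x)%C); split; [lra|]. intros v Hv. apply Hx.
  assert (T := Cmod_dist_triangle v w x). lra.
- apply Cmod_ball_open. intros x [HGx HNx].
  destruct (open_Cmod_ball G x Hop HGx) as (rho & Hrho & HGr).
  exists (rho / 3); split; [lra|]. intros w Hw. split; [apply HGr; lra|].
  (* If h vanished near a point w within rho/3 of x, it would vanish on the disc of radius 2 rho/3
     about w, which stays in G and contains the disc of radius rho/3 about x. *)
  intros (r & Hr & Hwr). apply HNx. exists (rho / 3); split; [lra|].
  intros v Hv. apply (zero_on_disc h w r (2 * rho / 3) Hr); [|exact Hwr|].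
  + intros u Hu. apply Hh, HGr. assert (T := Cmod_dist_triangle u w x). lra.
  + assert (T := Cmod_dist_triangle v x w). rewrite (Cmod_dist_sym x w) in T. lra.
- intros x Hx. destruct (classic (N x)); tauto.
- exists z0. repeat split; try assumption. exists r0; tauto.
- exists z. repeat split; try assumption. intros (r & Hr & K). apply Hne, K.
  unfold Cminus. rewrite Cplus_opp_r, Cmod_0. exact Hr.
- exact (HN' HN).
Qed.

(** * Flat functions vanish when gamma exceeds the index *)

Lemma max_modulus_rectangle (F : C -> C) (a b c d B : R) :
  (forall x y, a <= x <= b -> c <= y <= d -> holo_at F (x, y)) ->
  (forall x y, a <= x <= b -> c <= y <= d -> x = a \/ x = b \/ y = c \/ y = d ->
    Cmod (F (x, y)) <= B) ->
  forall x y, a <= x <= b -> c <= y <= d -> Cmod (F (x, y)) <= B.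
Proof.
intros HF HB x y Hx Hy.
set (K := fun z : C => a <= fst z <= b /\ c <= snd z <= d).
apply (max_modulus K F (Rmax (Rabs a) (Rabs b) + Rmax (Rabs c) (Rabs d))).
- intros [u v] [K1 K2]; simpl in *. eapply Rle_trans; [apply Cmod_le_Rabs|]. simpl.
  apply Rplus_le_compat; apply RmaxAbs; tauto.
- intros [u v] Hn.
  assert (Hcases : u < a \/ b < u \/ v < c \/ d < v).
  { apply NNPP; intro H. apply Hn. unfold K; simpl. lra. }
  assert (Hr : forall delta, (forall u' v', Rabs (u' - u) < delta -> Rabs (v' - v) < delta -> ~ K (u', v')) ->
    forall w, Cmod (w - (u, v))%C < delta -> ~ K w).
  { intros delta H [u' v'] Hw. apply H.
    - eapply Rle_lt_trans; [exact (Rabs_fst_minus_le (u', v') (u, v))|exact Hw].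
    - eapply Rle_lt_trans; [exact (Rabs_snd_minus_le (u', v') (u, v))|exact Hw]. }
  destruct Hcases as [H|[H|[H|H]]].
  + exists (a - u); split; [lra|]. apply Hr. intros u' v' H1 H2 [K1 K2]; simpl in *.
    apply Rabs_def2 in H1. lra.
  + exists (u - b); split; [lra|]. apply Hr. intros u' v' H1 H2 [K1 K2]; simpl in *.
    apply Rabs_def2 in H1. lra.
  + exists (c - v); split; [lra|]. apply Hr. intros u' v' H1 H2 [K1 K2]; simpl in *.
    apply Rabs_def2 in H2. lra.
  + exists (v - d); split; [lra|]. apply Hr. intros u' v' H1 H2 [K1 K2]; simpl in *.
    apply Rabs_def2 in H2. lra.
- intros [u v] [K1 K2]. apply HF; assumption.
- intros [u v] [K1 K2]; simpl in *.
  destruct (classic (u = a \/ u = b \/ v = c \/ v = d)) as [H|H]; [left; apply HB; assumption|right].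
  exists (Rmin (Rmin (u - a) (b - u)) (Rmin (v - c) (d - v))). split.
  + repeat apply Rmin_pos; lra.
  + intros [u' v'] Hw.
    assert (H1 := Rle_lt_trans _ _ _ (Rabs_fst_minus_le (u', v') (u, v)) Hw).
    assert (H2 := Rle_lt_trans _ _ _ (Rabs_snd_minus_le (u', v') (u, v)) Hw).
    simpl in H1, H2. apply Rabs_def2 in H1. apply Rabs_def2 in H2.
    assert (Q1 := Rmin_l (Rmin (u - a) (b - u)) (Rmin (v - c) (d - v))).
    assert (Q2 := Rmin_r (Rmin (u - a) (b - u)) (Rmin (v - c) (d - v))).
    assert (Q3 := Rmin_l (u - a) (b - u)). assert (Q4 := Rmin_r (u - a) (b - u)).
    assert (Q5 := Rmin_l (v - c) (d - v)). assert (Q6 := Rmin_r (v - c) (d - v)).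
    split; simpl; lra.
- split; assumption.
Qed.

(** * Quotients of a weight sequence and its index *)

Lemma quotient_pos (M : nat -> R) (p : nat) : weight_sequence M -> 0 < quotient M p.
Proof. intros [HM _]. apply Rdiv_lt_0_compat; apply HM. Qed.

Lemma quotient_incr (M : nat -> R) (p : nat) :
  weight_sequence M -> quotient M p <= quotient M (S p).
Proof.
intros (HM & _ & Hlc & _). specialize (Hlc (S p) ltac:(lia)).
replace (S p - 1)%nat with p in Hlc by lia. replace (S p + 1)%nat with (S (S p)) in Hlc by lia.
unfold quotient. assert (H0 := HM p). assert (H1 := HM (S p)).
apply Rle_div_l; [exact H0|].
replace (M (S (S p)) / M (S p) * M p) with (M p * M (S (S p)) / M (S p)) by (field; lra).
apply Rle_div_r; [exact H1|]. lra.
Qed.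

Lemma weight_succ (M : nat -> R) (p : nat) :
  weight_sequence M -> M (S p) = M p * quotient M p.
Proof. intros [HM _]. unfold quotient. field. apply Rgt_not_eq, HM. Qed.

(** M_p is the product of the first p quotients, which increase by log-convexity. A bound on the
    single quotient m_p thus controls M_p. *)
Lemma weight_le_quotient_pow (M : nat -> R) (p : nat) :
  weight_sequence M -> M p <= quotient M p ^ p.
Proof.
intros HM. induction p as [|p IH].
- destruct HM as (_ & H0 & _). rewrite H0. simpl. lra.
- rewrite weight_succ by exact HM. assert (Hp := quotient_pos M p HM).
  apply Rle_trans with (quotient M p ^ p * quotient M p).
  + apply Rmult_le_compat_r; lra.
  + rewrite Rmult_comm. apply (pow_incr _ _ (S p)). split; [lra|].
    apply quotient_incr, HM.
Qed.

Lemma omega_lt_frequently (M : nat -> R) (gamma : R) :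
  weight_sequence M -> 0 < gamma -> Rbar_lt (omega M) (Finite gamma) ->
  exists g, 0 < g < gamma /\
    forall N, exists p, (N <= p)%nat /\ (2 <= p)%nat /\ quotient M p <= exp (g * ln (INR p)).
Proof.
intros HM Hg Hlt.
assert (Hfreq : exists g, 0 < g < gamma /\ forall N, exists p, (N <= p)%nat /\
  ln (quotient M p) / ln (INR p) < g).
{ unfold omega, LimInf_seq in Hlt.
  destruct ex_LimInf_seq as [l Hl]; simpl in Hlt.
  destruct l as [l| |]; simpl in Hl, Hlt.
  (* [Rmax l 0] makes g positive without an appeal to omega >= 0. *)
  - exists ((Rmax l 0 + gamma) / 2).
    assert (Q1 := Rmax_l l 0). assert (Q2 := Rmax_r l 0).
    assert (Q3 : Rmax l 0 < gamma) by (apply Rmax_lub_lt; lra).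
    split; [lra|].
    assert (He : 0 < (Rmax l 0 + gamma) / 2 - l) by lra.
    destruct (Hl (mkposreal _ He)) as [K _]. intro N. destruct (K N) as (p & Hp & Kp).
    exists p; split; [exact Hp|]. simpl in Kp. lra.
  - contradiction.
  - exists (gamma / 2); split; [lra|]. intro N. apply Hl. }
destruct Hfreq as (g & Hg1 & H). exists g; split; [exact Hg1|]. intro N.
destruct (H (max N 2)) as (p & Hp & K). exists p. split; [lia|]. split; [lia|].
assert (H2 : 2 <= INR p) by (apply (le_INR 2); lia).
assert (Hln : 0 < ln (INR p)) by (rewrite <- ln_1; apply ln_increasing; lra).
apply Rlt_div_l in K; [|exact Hln].
rewrite <- (exp_ln (quotient M p)) by (apply quotient_pos, HM).
left. apply exp_increasing, K.
Qed.

Lemma exp_pow_INR (x : R) (n : nat) : exp x ^ n = exp (INR n * x).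
Proof.
induction n as [|n IH]; [simpl; rewrite Rmult_0_l, exp_0; reflexivity|].
rewrite S_INR. simpl. rewrite IH, <- exp_plus. f_equal. ring.
Qed.

Lemma exp_le_compat (x y : R) : x <= y -> exp x <= exp y.
Proof. intros [H| ->]; [left; apply exp_increasing, H|right; reflexivity]. Qed.

Section FlatFunctions.

Variables (M : nat -> R) (h : C -> C) (g b x0 C0 A : R).
Hypothesis (HM : weight_sequence M) (Hb : 0 < g < b) (HC : 0 < C0) (HA : 0 < A).
Hypothesis (Hfreq : forall N, exists p, (N <= p)%nat /\ (2 <= p)%nat /\
  quotient M p <= exp (g * ln (INR p))).
Hypothesis (Hholo : forall s, Re s <= x0 -> Rabs (Im s) <= b * (PI / 2) -> holo_at h s).
Hypothesis (Hflat : forall s p, Re s <= x0 -> Rabs (Im s) <= b * (PI / 2) ->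
  Cmod (h s) <= C0 * A ^ p * M p * exp (Re s) ^ p).

(* On the left side Re s = xp of a long rectangle the flatness bound at order p gives
   |h| <= C0 exp(-p), which absorbs the weight exp(L exp(-s/b)) because g < b. *)
Lemma flat_weighted_bound (L x y : R) : 0 <= L -> x <= x0 -> Rabs y <= b * (PI / 2) ->
  Cmod (h (x, y)) * exp (L * (exp (- x / b) * cos (y / b))) <= C0 * exp (L * exp (- x0 / b)).
Proof.
intros HL Hx Hy. assert (HPI := PI_RGT_0).
assert (Hk : 0 < 1 - g / b).
{ assert (g / b < 1) by (apply Rlt_div_l; lra). lra. }
(* Lower bounds for ln p: the first entry makes the exponent of the weight at most p on the left
   side, the second puts that side to the left of x. The summand 1 keeps the logarithm meaningful
   for L = 0. *)
set (T := Rmax (ln (L * exp ((1 + ln A) / b) + 1) / (1 - g / b)) (Rmax ((- 1 - ln A - x) / g) 0)).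
destruct (INR_unbounded (exp T)) as [N HN].
destruct (Hfreq N) as (p & HpN & Hp2 & Hmp).
assert (HINR : 2 <= INR p) by (apply (le_INR 2); lia).
assert (HT : T <= ln (INR p)).
{ rewrite <- (ln_exp T). apply ln_le; [apply exp_pos|]. apply le_INR in HpN. lra. }
set (l := ln (INR p)) in *.
assert (HT1 : ln (L * exp ((1 + ln A) / b) + 1) <= (1 - g / b) * l).
{ rewrite (Rmult_comm (1 - g / b)). apply Rle_div_l; [exact Hk|]. eapply Rle_trans; [apply Rmax_l|exact HT]. }
assert (HT2 : - 1 - ln A - x <= g * l).
{ rewrite (Rmult_comm g). apply Rle_div_l; [lra|].
  eapply Rle_trans; [|exact HT]. eapply Rle_trans; [|apply Rmax_r]. apply Rmax_l. }
(* Chosen so that A p^g exp(xp) = exp(-1); then A^p M_p exp(xp)^p <= exp(-p). *)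
set (xp := - 1 - ln A - g * l).
assert (Hxp : xp <= x) by (unfold xp; lra).
assert (HLp : L * exp (- xp / b) <= INR p).
{ replace (- xp / b) with ((1 + ln A) / b + (g / b) * l) by (unfold xp; field; lra).
  rewrite exp_plus, <- Rmult_assoc.
  assert (E0 := exp_pos ((1 + ln A) / b)).
  assert (K : L * exp ((1 + ln A) / b) <= exp ((1 - g / b) * l)).
  { assert (0 <= L * exp ((1 + ln A) / b)) by (apply Rmult_le_pos; lra).
    apply Rle_trans with (L * exp ((1 + ln A) / b) + 1); [lra|].
    rewrite <- (exp_ln (L * exp ((1 + ln A) / b) + 1)) by lra.
    apply exp_le_compat, HT1. }
  apply Rle_trans with (exp ((1 - g / b) * l) * exp (g / b * l)).
  - apply Rmult_le_compat_r; [left; apply exp_pos|exact K].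
  - rewrite <- exp_plus. replace ((1 - g / b) * l + g / b * l) with l by ring.
    unfold l. rewrite exp_ln; lra. }
(* This is exp(L z^(-1/b)) in the chart. Its modulus is 1 on the sides |Im s| = b pi/2, where the
   bound of order 0 on h suffices. *)
set (W := fun s : C => Cexp (RtoC L * Cexp (RtoC (- / b) * s))%C).
assert (HW : forall u v, Cmod (W (u, v)) = exp (L * (exp (- u / b) * cos (v / b)))).
{ intros u v. unfold W. rewrite Cmod_Cexp. f_equal.
  unfold Cexp, Re, Im, Cmult, RtoC; simpl.
  replace (- / b * u - 0 * v) with (- u / b) by (field; lra).
  replace (- / b * v + 0 * u) with (- (v / b)) by (field; lra).
  rewrite cos_neg. ring. }
assert (HvB : forall v, - (b * (PI / 2)) <= v <= b * (PI / 2) -> Rabs v <= b * (PI / 2)).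
{ intros v Hv. apply Rabs_le. lra. }
assert (HM0 : M 0%nat = 1) by apply HM.
assert (H00 : forall u v, u <= x0 -> - (b * (PI / 2)) <= v <= b * (PI / 2) -> Cmod (h (u, v)) <= C0).
{ intros u v Hu Hv. specialize (Hflat (u, v) 0%nat Hu (HvB v Hv)).
  rewrite HM0 in Hflat. simpl in Hflat. lra. }
assert (Hfin : Cmod (h (x, y) * W (x, y))%C <= C0 * exp (L * exp (- x0 / b))).
{ apply (max_modulus_rectangle (fun s => h s * W s)%C xp x0 (- (b * (PI / 2))) (b * (PI / 2))).
  - intros u v Hu Hv. apply holo_at_mult; [apply Hholo; simpl; [lra|apply HvB, Hv]|].
    apply (holo_at_comp Cexp); [apply holo_at_Cexp|]. apply holo_at_scal.
    apply (holo_at_comp Cexp); [apply holo_at_Cexp|]. apply holo_at_scal, holo_at_id.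
  - intros u v Hu Hv Hside. rewrite Cmod_mult, HW.
    assert (Hh := H00 u v ltac:(lra) Hv). assert (Hh0 := Cmod_ge_0 (h (u, v))).
    assert (HE : 0 <= L * exp (- x0 / b)) by (apply Rmult_le_pos; [lra|left; apply exp_pos]).
    assert (HE1 : 1 <= exp (L * exp (- x0 / b))) by (rewrite <- exp_0; apply exp_le_compat, HE).
    assert (Hcos : L * (exp (- u / b) * cos (v / b)) <= L * exp (- u / b)).
    { apply Rmult_le_compat_l; [lra|]. rewrite <- (Rmult_1_r (exp (- u / b))) at 2.
      apply Rmult_le_compat_l; [left; apply exp_pos|apply COS_bound]. }
    destruct Hside as [Hs|[Hs|Hs]].
    + subst u. apply Rle_trans with (C0 * exp (- INR p) * exp (INR p)).
      * apply Rmult_le_compat; [lra|left; apply exp_pos| |apply exp_le_compat; lra].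
        eapply Rle_trans; [apply (Hflat (xp, v) p); simpl; [lra|apply HvB, Hv]|].
        rewrite !Rmult_assoc. apply Rmult_le_compat_l; [lra|]. simpl Re.
        apply Rle_trans with (exp (INR p * ln A) * (exp (INR p * (g * l)) * exp (INR p * xp))).
        -- rewrite exp_pow_INR, <- (exp_pow_INR (ln A)), exp_ln by exact HA.
           apply Rmult_le_compat_l; [apply pow_le; lra|].
           apply Rmult_le_compat_r; [left; apply exp_pos|].
           rewrite <- exp_pow_INR. eapply Rle_trans; [apply weight_le_quotient_pow, HM|].
           apply pow_incr. split; [left; apply quotient_pos, HM|exact Hmp].
        -- rewrite <- !exp_plus. apply exp_le_compat. unfold xp. lra.
      * rewrite Rmult_assoc, <- exp_plus, Rplus_opp_l, exp_0.
        apply Rmult_le_compat_l; lra.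
    + subst u. apply Rmult_le_compat; [lra|left; apply exp_pos|lra|].
      apply exp_le_compat, Hcos.
    + assert (Hc0 : cos (v / b) = 0).
      { destruct Hs as [-> | ->].
        - replace (- (b * (PI / 2)) / b) with (- (PI / 2)) by (field; lra).
          rewrite cos_neg. apply cos_PI2.
        - replace (b * (PI / 2) / b) with (PI / 2) by (field; lra). apply cos_PI2. }
      rewrite Hc0, !Rmult_0_r, exp_0. apply Rmult_le_compat; lra.
  - lra.
  - apply Rabs_le_between in Hy. lra. }
rewrite Cmod_mult, HW in Hfin. exact Hfin.
Qed.

(** The cosine is at least 1/2 for |y| <= b pi/3, and shifting x by b ln 2 more than doubles
    exp(-x/b). The weight at (x, y) then grows faster in L than the bound taken at x0, and L = n
    tends to infinity. *)
Lemma flat_eq_0 (x y : R) : x < x0 - b * ln 2 -> Rabs y <= b * (PI / 3) -> h (x, y) = 0%C.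
Proof.
intros Hx Hy. assert (HPI := PI_RGT_0). assert (Hl2 := ln_lt_2).
assert (Hbl : 0 < b * ln 2) by (apply Rmult_lt_0_compat; lra).
set (u := exp (- x / b) * cos (y / b) - exp (- x0 / b)).
assert (Hu : 0 < u).
{ unfold u.
  assert (Hcos : 1 / 2 <= cos (y / b)).
  { rewrite <- cos_PI3. rewrite <- (Rabs_pos_eq (PI / 3)) by lra.
    assert (Hyb : Rabs (y / b) <= PI / 3).
    { rewrite Rabs_div by lra. rewrite (Rabs_pos_eq b) by lra. apply Rle_div_l; lra. }
    rewrite (Rabs_pos_eq (PI / 3)) by lra.
    assert (P := Rabs_pos (y / b)).
    replace (cos (y / b)) with (cos (Rabs (y / b))).
    - apply cos_decr_1; lra.
    - unfold Rabs. destruct Rcase_abs; [apply cos_neg|reflexivity]. }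
  assert (Hexp : 2 * exp (- x0 / b) < exp (- x / b)).
  { rewrite <- (exp_ln 2) at 1 by lra. rewrite <- exp_plus. apply exp_increasing.
    apply Rmult_lt_reg_r with b; [lra|].
    replace ((ln 2 + - x0 / b) * b) with (b * ln 2 - x0) by (field; lra).
    replace (- x / b * b) with (- x) by (field; lra). lra. }
  assert (E0 := exp_pos (- x0 / b)). assert (E1 := exp_pos (- x / b)).
  assert (exp (- x / b) * (1 / 2) <= exp (- x / b) * cos (y / b)) by (apply Rmult_le_compat_l; lra).
  lra. }
apply Cmod_eq_0. apply (le_geometric_eq_0 _ C0 (exp (- u))).
- apply Cmod_ge_0.
- split; [left; apply exp_pos|]. rewrite <- exp_0. apply exp_increasing. lra.
- intro n.
  assert (Hy' : Rabs y <= b * (PI / 2)).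
  { eapply Rle_trans; [exact Hy|]. apply Rmult_le_compat_l; lra. }
  assert (H := flat_weighted_bound (INR n) x y (pos_INR n) ltac:(lra) Hy').
  rewrite exp_pow_INR.
  apply (Rmult_le_reg_r (exp (INR n * (exp (- x / b) * cos (y / b))))); [apply exp_pos|].
  eapply Rle_trans; [exact H|]. right. rewrite Rmult_assoc, <- exp_plus. do 2 f_equal.
  unfold u. ring.
Qed.

End FlatFunctions.

Lemma injective_of_omega_lt (M : nat -> R) (gamma : R) (G : LogSurface -> Prop) :
  weight_sequence M -> 0 < gamma -> sectorial_region gamma G ->
  Rbar_lt (omega M) (Finite gamma) -> borel_map_injective M G.
Proof.
intros HM Hgamma HG Hlt f1 f2 Hf1 Hf2 Heq z Hz. assert (HPI := PI_RGT_0).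
destruct (omega_lt_frequently M gamma HM Hgamma Hlt) as (g & Hg & Hfreq).
(* The closed strip of width b pi lies in the sector of opening b1 pi, whose closure lies in the
   sector of opening b2 pi contained in G near the vertex. *)
set (b := (2 * g + gamma) / 3). set (b1 := (g + 2 * gamma) / 3). set (b2 := (b1 + gamma) / 2).
assert (Hb : g < b /\ b < b1 /\ b1 < b2 /\ b2 < gamma) by (unfold b2, b1, b; lra).
destruct HG as (Hop & Hcon & _ & Hsec).
destruct (Hsec b2 ltac:(lra)) as (rho & Hrho & HinG).
assert (HT : proper_subsector (bounded_sector 0 b1 (rho / 2)) G).
{ split.
  - exists 0, b1, (rho / 2). split; [lra|]. split; [lra|]. tauto.
  - intros w Hw. apply HinG. revert Hw. apply closure_bounded_sector; lra. }
assert (E1 := borel_map_spec M G f1 Hf1). assert (E2 := borel_map_spec M G f2 Hf2).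
rewrite <- Heq in E2. set (a := borel_map M G f1) in *.
destruct (E1 _ HT) as (C1 & A1 & HC1 & HA1 & B1).
destruct (E2 _ HT) as (C2 & A2 & HC2 & HA2 & B2).
set (h := fun s : C => (f1 s - f2 s)%C).
assert (Hh : forall s, G s -> holo_at h s).
{ intros s Hs. apply holo_at_minus; apply ex_derive_holo_at; [apply Hf1|apply Hf2]; exact Hs. }
set (x0 := ln (rho / 2) - 1).
assert (HinT : forall s : C, Re s <= x0 -> Rabs (Im s) <= b * (PI / 2) ->
  bounded_sector 0 b1 (rho / 2) s).
{ intros s H1 H2. split.
  - unfold argument. rewrite Rminus_0_r. eapply Rle_lt_trans; [exact H2|].
    replace (b1 * PI / 2) with (b1 * (PI / 2)) by field. apply Rmult_lt_compat_r; lra.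
  - unfold modulus. rewrite <- (exp_ln (rho / 2)) by lra. apply exp_increasing.
    unfold x0 in H1. lra. }
assert (HinG' : forall s, bounded_sector 0 b1 (rho / 2) s -> G s).
{ intros s [H1 H2]. apply HinG. split; [|lra]. eapply Rlt_trans; [exact H1|].
  unfold Rdiv. apply Rmult_lt_compat_r; [lra|]. apply Rmult_lt_compat_r; lra. }
assert (Hzero : forall x y, x < x0 - b * ln 2 -> Rabs y <= b * (PI / 3) -> h (x, y) = 0%C).
{ apply (flat_eq_0 M h g b x0 (C1 + C2) (Rmax A1 A2)); try assumption; try lra.
  - eapply Rlt_le_trans; [exact HA1|apply Rmax_l].
  - intros s H1 H2. apply Hh, HinG', HinT; assumption.
  - intros s p H1 H2. assert (Hs := HinT s H1 H2).
    specialize (B1 s p Hs). specialize (B2 s p Hs).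
    unfold h.
    replace (f1 s - f2 s)%C with ((f1 s - partial_sum a (proj s) p) + - (f2 s - partial_sum a (proj s) p))%C by ring.
    eapply Rle_trans; [apply Cmod_triangle|]. rewrite Cmod_opp.
    assert (HMp : 0 <= M p * modulus s ^ p).
    { apply Rmult_le_pos; [left; apply HM|]. apply pow_le. left. apply exp_pos. }
    assert (D1 : A1 ^ p <= Rmax A1 A2 ^ p) by (apply pow_incr; split; [lra|apply Rmax_l]).
    assert (D2 : A2 ^ p <= Rmax A1 A2 ^ p) by (apply pow_incr; split; [lra|apply Rmax_r]).
    change (exp (Re s)) with (modulus s).
    apply Rle_trans with (C1 * Rmax A1 A2 ^ p * M p * modulus s ^ p + C2 * Rmax A1 A2 ^ p * M p * modulus s ^ p).
    + apply Rplus_le_compat.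
      * eapply Rle_trans; [exact B1|]. rewrite !(Rmult_assoc _ (M p)).
        apply Rmult_le_compat_r; [exact HMp|]. apply Rmult_le_compat_l; lra.
      * eapply Rle_trans; [exact B2|]. rewrite !(Rmult_assoc _ (M p)).
        apply Rmult_le_compat_r; [exact HMp|]. apply Rmult_le_compat_l; lra.
    + right. ring. }
assert (Hhz : h z = 0%C).
{ set (r := Rmin 1 (b * (PI / 3))).
  assert (Hr1 : r <= 1) by apply Rmin_l. assert (Hr2 : r <= b * (PI / 3)) by apply Rmin_r.
  assert (Hl2 := ln_lt_2).
  assert (Hbl : 0 < b * ln 2) by (apply Rmult_lt_0_compat; lra).
  apply (identity_theorem G h (x0 - b * ln 2 - 1, 0) r); try assumption.
  - apply HinG', HinT; simpl; [lra|]. rewrite Rabs_R0. apply Rmult_le_pos; lra.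
  - apply Rmin_pos; [lra|]. apply Rmult_lt_0_compat; lra.
  - intros [u v] Hw.
    assert (K1 := Rle_lt_trans _ _ _ (Rabs_fst_minus_le _ _) Hw).
    assert (K2 := Rle_lt_trans _ _ _ (Rabs_snd_minus_le _ _) Hw).
    simpl in K1, K2. rewrite Rminus_0_r in K2. apply Rabs_def2 in K1.
    apply Hzero; lra. }
unfold h in Hhz. replace (f1 z) with ((f1 z - f2 z) + f2 z)%C by ring.
rewrite Hhz. ring.
Qed.

(** * Weighted sums of exponentials *)

Lemma positive_lower_bound (u : nat -> R) (c : R) (N : nat) :
  (forall n, 0 < u n) -> 0 < c -> (forall n, (N <= n)%nat -> c <= u n) ->
  exists a, 0 < a /\ forall n, a <= u n.
Proof.
intros Hu. revert c. induction N as [|N IH]; intros c Hc H.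
- exists c; split; [exact Hc|]. intro n. apply H. lia.
- apply (IH (Rmin c (u N))).
  + apply Rmin_pos; [exact Hc|apply Hu].
  + intros n Hn. destruct (Nat.eq_dec n N) as [->|Hne]; [apply Rmin_r|].
    eapply Rle_trans; [apply Rmin_l|apply H; lia].
Qed.

Lemma omega_ge_quotient_lower (M : nat -> R) (gamma kappa : R) :
  weight_sequence M -> ~ Rbar_lt (omega M) (Finite gamma) -> 0 < kappa < gamma ->
  exists a, 0 < a /\ forall p, a * exp (kappa * ln (INR p + 1)) <= quotient M p.
Proof.
intros HM Hge Hk.
assert (Hev : exists N, forall n, (N <= n)%nat -> kappa < ln (quotient M n) / ln (INR n)).
{ unfold omega, LimInf_seq in Hge.
  destruct ex_LimInf_seq as [l Hl]; simpl in Hge.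
  destruct l as [l| |]; simpl in Hl, Hge.
  - assert (He : 0 < l - kappa) by lra.
    destruct (Hl (mkposreal _ He)) as [_ [N HN]]. exists N. intros n Hn.
    specialize (HN n Hn). simpl in HN. lra.
  - apply Hl.
  - exfalso. apply Hge. exact I. }
destruct Hev as [N HN].
(* With p + 1 in place of p the bound makes sense at p = 0; for n >= 2 the inequality n + 1 <= 2 n
   costs the factor 2^(-kappa). *)
destruct (positive_lower_bound (fun p => quotient M p / exp (kappa * ln (INR p + 1)))
  (exp (- kappa * ln 2)) (max N 2)) as (a & Ha & H).
- intro n. apply Rdiv_lt_0_compat; [apply quotient_pos, HM|apply exp_pos].
- apply exp_pos.
- intros n Hn. specialize (HN n ltac:(lia)).
  assert (H2 : 2 <= INR n) by (apply (le_INR 2); lia).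
  assert (Hln : 0 < ln (INR n)) by (rewrite <- ln_1; apply ln_increasing; lra).
  apply Rle_div_r; [apply exp_pos|]. rewrite <- exp_plus.
  rewrite <- (exp_ln (quotient M n)) by (apply quotient_pos, HM). apply exp_le_compat.
  apply Rlt_div_r in HN; [|exact Hln].
  assert (K : ln (INR n + 1) <= ln 2 + ln (INR n)).
  { rewrite <- ln_mult by lra. apply ln_le; lra. }
  assert (kappa * ln (INR n + 1) <= kappa * (ln 2 + ln (INR n))) by (apply Rmult_le_compat_l; lra).
  lra.
- exists a; split; [exact Ha|]. intro p. apply Rle_div_r; [apply exp_pos|apply H].
Qed.

(** The sum of the logarithms of the quotients is compared with Stirling's lower bound p ln p - p
    for ln p!, scaled by kappa. The induction step is p ln(1 + 1/p) <= 1. *)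
Lemma ln_weight_lower (M : nat -> R) (kappa a : R) :
  weight_sequence M -> 0 < kappa -> 0 < a ->
  (forall p, a * exp (kappa * ln (INR p + 1)) <= quotient M p) ->
  forall p, INR p * ln a + kappa * (INR p * ln (INR p) - INR p) <= ln (M p).
Proof.
intros HM Hk Ha H p. induction p as [|p IH].
- destruct HM as (_ & -> & _). rewrite ln_1. simpl. lra.
- rewrite (weight_succ M) by exact HM.
  rewrite ln_mult; [|apply HM|apply quotient_pos, HM].
  assert (K : ln a + kappa * ln (INR p + 1) <= ln (quotient M p)).
  { rewrite <- (ln_exp (kappa * ln (INR p + 1))), <- ln_mult; [|exact Ha|apply exp_pos].
    apply ln_le; [apply Rmult_lt_0_compat; [exact Ha|apply exp_pos]|apply H]. }
  assert (L : INR p * (ln (INR p + 1) - ln (INR p)) <= 1).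
  { destruct p as [|p]; [simpl; lra|].
    assert (Hp : 0 < INR (S p)) by (apply lt_0_INR; lia).
    set (x := INR (S p)) in *.
    rewrite <- ln_div by lra.
    assert (E : ln ((x + 1) / x) <= 1 / x).
    { rewrite <- (ln_exp (1 / x)). apply ln_le; [apply Rdiv_lt_0_compat; lra|].
      eapply Rle_trans; [|apply exp_ineq1_le]. right. field. lra. }
    apply Rle_trans with (x * (1 / x)); [apply Rmult_le_compat_l; lra|right; field; lra]. }
  rewrite S_INR.
  assert (kappa * (INR p * (ln (INR p + 1) - ln (INR p))) <= kappa * 1) by (apply Rmult_le_compat_l; lra).
  lra.
Qed.

(** The supremum over p of the left side is the associated function of M at exp(y). The loss lambda
    > 1 reflects that a lower limit only yields exponents kappa = gamma / lambda below gamma. *)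
Lemma associated_function_bound (M : nat -> R) (gamma lambda : R) :
  weight_sequence M -> 0 < gamma -> ~ Rbar_lt (omega M) (Finite gamma) -> 1 < lambda ->
  exists C0, 0 < C0 /\ forall p y, INR p * y - ln (M p) <= C0 * exp (lambda * y / gamma).
Proof.
intros HM Hg Hge Hl.
set (kappa := gamma / lambda).
assert (Hk : 0 < kappa < gamma).
{ unfold kappa. split; [apply Rdiv_lt_0_compat; lra|]. apply Rlt_div_l; [lra|]. nra. }
destruct (omega_ge_quotient_lower M gamma kappa HM Hge Hk) as (a & Ha & H).
exists (kappa * exp (- ln a / kappa)). split; [apply Rmult_lt_0_compat; [lra|apply exp_pos]|].
intros p y. assert (L := ln_weight_lower M kappa a HM (proj1 Hk) Ha H p).
(* In terms of t the right side is kappa exp(t), and the claim becomes x (t - ln x + 1) <= exp(t),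
   which is 1 + u <= exp(u) at u = t - ln x. *)
set (t := (y - ln a) / kappa).
assert (Ht : y = ln a + kappa * t) by (unfold t; field; lra).
rewrite Rmult_assoc, <- exp_plus.
replace (- ln a / kappa + lambda * y / gamma) with t by (unfold t, kappa; field; lra).
apply Rle_trans with (kappa * (INR p * (t - ln (INR p) + 1))).
- rewrite Ht at 1. lra.
- apply Rmult_le_compat_l; [lra|]. destruct p as [|p].
  + simpl. rewrite Rmult_0_l. left. apply exp_pos.
  + assert (Hp : 0 < INR (S p)) by (apply lt_0_INR; lia).
    set (x := INR (S p)) in *. assert (E := exp_ineq1_le (t - ln x)).
    apply Rle_trans with (x * exp (t - ln x)); [apply Rmult_le_compat_l; lra|].
    right. rewrite <- (exp_ln x) at 1 by lra. rewrite <- exp_plus. f_equal. ring.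
Qed.

Lemma Series_half : ex_series (fun k => (1 / 2) ^ S k) /\ Series (fun k => (1 / 2) ^ S k) = 1.
Proof.
assert (Hq : Rabs (1 / 2) < 1) by (rewrite Rabs_pos_eq; lra).
split.
- apply (ex_series_scal_l (1 / 2) (fun k => (1 / 2) ^ k)). exists (/ (1 - 1 / 2)).
  apply is_series_geom, Hq.
- simpl. rewrite Series_scal_l, Series_geom by exact Hq. field.
Qed.

Lemma Series_ge_0 (a : nat -> R) : (forall k, 0 <= a k) -> ex_series a -> 0 <= Series a.
Proof.
intros Ha Hex. rewrite <- (Rmult_0_l (Series a)), <- Series_scal_l.
apply Series_le; [|exact Hex]. intro k. specialize (Ha k). lra.
Qed.

Lemma Series_ge_term (a : nat -> R) (n : nat) :
  (forall k, 0 <= a k) -> ex_series a -> a n <= Series a.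
Proof.
revert a. induction n as [|n IH]; intros a Ha Hex; rewrite Series_incr_1 by exact Hex.
- assert (K := Series_ge_0 (fun k => a (S k)) ltac:(intro k; apply Ha) (proj1 (ex_series_incr_1 a) Hex)). lra.
- assert (K := IH (fun k => a (S k)) ltac:(intro k; apply Ha) (proj1 (ex_series_incr_1 a) Hex)).
  specialize (Ha 0%nat). simpl in K. lra.
Qed.

Section WeightedSums.

Variable c : nat -> R.
Hypothesis Hc : forall k, 0 < c k <= (1 / 2) ^ S k.

(** A positive linear functional on bounded sequences, of total mass at most 1. The bounds A and B
    in the lemmas below only ensure convergence. *)
Definition wsum (a : nat -> R) : R := Series (fun k => c k * a k).

Lemma ex_wsum (a : nat -> R) (B : R) : (forall k, Rabs (a k) <= B) ->
  ex_series (fun k => c k * a k).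
Proof.
intros Ha. apply (ex_series_le (V := R_CompleteNormedModule) _ (fun k => B * (1 / 2) ^ S k)).
- intro k. unfold norm; simpl. unfold abs; simpl. specialize (Hc k).
  rewrite Rabs_mult, (Rabs_pos_eq (c k)), (Rmult_comm B) by lra.
  apply Rmult_le_compat; [lra|apply Rabs_pos|apply Hc|apply Ha].
- apply (ex_series_scal_l B (fun k => (1 / 2) ^ S k)), Series_half.
Qed.

Lemma wsum_plus (a b : nat -> R) (A B : R) :
  (forall k, Rabs (a k) <= A) -> (forall k, Rabs (b k) <= B) ->
  wsum (fun k => a k + b k) = wsum a + wsum b.
Proof.
intros Ha Hb. unfold wsum. rewrite <- Series_plus by (eapply ex_wsum; eassumption).
apply Series_ext. intro k. ring.
Qed.

Lemma wsum_scal (x : R) (a : nat -> R) : wsum (fun k => x * a k) = x * wsum a.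
Proof.
unfold wsum. rewrite <- Series_scal_l. apply Series_ext. intro k. ring.
Qed.

Lemma wsum_le (a b : nat -> R) (A B : R) :
  (forall k, Rabs (a k) <= A) -> (forall k, Rabs (b k) <= B) ->
  (forall k, a k <= b k) -> wsum a <= wsum b.
Proof.
intros Ha Hb Hab.
(* The terms may have any sign, so the comparison is reduced to the nonnegative difference. *)
assert (E : wsum b = wsum a + wsum (fun k => b k + -1 * a k)).
{ rewrite (wsum_plus b (fun k => -1 * a k) B A), wsum_scal; [ring|exact Hb|].
  intro k. rewrite Rabs_mult, Rabs_m1, Rmult_1_l. apply Ha. }
assert (0 <= wsum (fun k => b k + -1 * a k)).
{ unfold wsum. apply Series_ge_0.
  - intro k. specialize (Hc k). specialize (Hab k). apply Rmult_le_pos; lra.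
  - apply (ex_wsum _ (B + A)). intro k. eapply Rle_trans; [apply Rabs_triang|].
    rewrite Rabs_mult, Rabs_m1, Rmult_1_l. apply Rplus_le_compat; [apply Hb|apply Ha]. }
lra.
Qed.

Lemma wsum_1_bounds : 0 <= wsum (fun _ => 1) <= 1.
Proof.
destruct Series_half as [Hex Hs]. split.
- unfold wsum. apply Series_ge_0.
  + intro k. specialize (Hc k). lra.
  + apply (ex_wsum _ 1). intro k. rewrite Rabs_R1. lra.
- apply Rle_trans with (2 := Req_le _ _ Hs). apply Series_le; [|exact Hex].
  intro k. destruct (Hc k) as [H1 H2]. rewrite Rmult_1_r. split; [lra|exact H2].
Qed.

Lemma Rabs_wsum_le (a : nat -> R) (B : R) : (forall k, Rabs (a k) <= B) -> Rabs (wsum a) <= B.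
Proof.
intros Ha. assert (H1 := wsum_1_bounds).
assert (HB : 0 <= B) by (eapply Rle_trans; [apply Rabs_pos|apply (Ha 0%nat)]).
assert (HBk : forall x, Rabs x <= B -> forall k : nat, Rabs (x * 1) <= B) by (intros x Hx _; rewrite Rmult_1_r; exact Hx).
assert (U : wsum a <= wsum (fun _ => B * 1)).
{ apply (wsum_le _ _ B B); [exact Ha|apply HBk; rewrite Rabs_pos_eq; lra|].
  intro k. specialize (Ha k). apply Rabs_le_between in Ha. lra. }
assert (L : wsum (fun _ => - B * 1) <= wsum a).
{ apply (wsum_le _ _ B B); [apply HBk; rewrite Rabs_Ropp, Rabs_pos_eq; lra|exact Ha|].
  intro k. specialize (Ha k). apply Rabs_le_between in Ha. lra. }
rewrite wsum_scal in U, L. apply Rabs_le_between. nra.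
Qed.

Definition csum (z : nat -> C) : C := (wsum (fun k => fst (z k)), wsum (fun k => snd (z k))).

Lemma csum_plus (z w : nat -> C) (A B : R) :
  (forall k, Cmod (z k) <= A) -> (forall k, Cmod (w k) <= B) ->
  csum (fun k => z k + w k)%C = (csum z + csum w)%C.
Proof.
intros Hz Hw. unfold csum, Cplus. simpl. f_equal.
- apply (wsum_plus _ _ A B); intro k; (eapply Rle_trans; [apply Rabs_fst_le_Cmod|auto]).
- apply (wsum_plus _ _ A B); intro k; (eapply Rle_trans; [apply Rabs_snd_le_Cmod|auto]).
Qed.

Lemma csum_scal (u : C) (z : nat -> C) (A : R) : (forall k, Cmod (z k) <= A) ->
  csum (fun k => u * z k)%C = (u * csum z)%C.
Proof.
intros Hz. destruct u as [x y].
assert (H1 : forall t k, Rabs (t * fst (z k)) <= Rabs t * A).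
{ intros t k. rewrite Rabs_mult. apply Rmult_le_compat_l; [apply Rabs_pos|].
  eapply Rle_trans; [apply Rabs_fst_le_Cmod|auto]. }
assert (H2 : forall t k, Rabs (t * snd (z k)) <= Rabs t * A).
{ intros t k. rewrite Rabs_mult. apply Rmult_le_compat_l; [apply Rabs_pos|].
  eapply Rle_trans; [apply Rabs_snd_le_Cmod|auto]. }
unfold csum, Cmult. simpl. f_equal.
- replace (fun k => x * fst (z k) - y * snd (z k)) with (fun k => x * fst (z k) + - y * snd (z k))
    by (apply functional_extensionality; intro k; ring).
  rewrite (wsum_plus (fun k => x * fst (z k)) (fun k => - y * snd (z k)) _ _ (H1 x) (H2 (- y))).
  rewrite !wsum_scal. ring.
- rewrite (wsum_plus (fun k => x * snd (z k)) (fun k => y * fst (z k)) _ _ (H2 x) (H1 y)).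
  rewrite !wsum_scal. ring.
Qed.

(** The factor 2 comes from estimating the two components separately. *)
Lemma Cmod_csum_le (z : nat -> C) (B : R) : (forall k, Cmod (z k) <= B) -> Cmod (csum z) <= 2 * B.
Proof.
intros Hz. eapply Rle_trans; [apply Cmod_le_Rabs|]. simpl.
assert (H1 := Rabs_wsum_le (fun k => fst (z k)) B (fun k => Rle_trans _ _ _ (Rabs_fst_le_Cmod (z k)) (Hz k))).
assert (H2 := Rabs_wsum_le (fun k => snd (z k)) B (fun k => Rle_trans _ _ _ (Rabs_snd_le_Cmod (z k)) (Hz k))).
lra.
Qed.

Variable lam : nat -> R.
Hypothesis Hlam : forall k, 1 < lam k <= 3 / 2.

Definition exp_sum (s : C) : C := csum (fun k => Cexp (RtoC (lam k) * s)%C).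

Definition real_exp_sum (x : R) : R := wsum (fun k => exp (lam k * x)).

Lemma exp_lam_bound (x : R) (k : nat) : exp (lam k * x) <= exp (2 * Rabs x).
Proof.
apply exp_le_compat. specialize (Hlam k). assert (H1 := Rle_abs x). assert (H2 := Rabs_pos x).
apply Rle_trans with (lam k * Rabs x); [apply Rmult_le_compat_l|apply Rmult_le_compat_r]; lra.
Qed.

Lemma Rabs_exp_lam_bound (x : R) (k : nat) : Rabs (exp (lam k * x)) <= exp (2 * Rabs x).
Proof. rewrite Rabs_pos_eq by (left; apply exp_pos). apply exp_lam_bound. Qed.

Lemma Cmod_Cexp_lam (s : C) (k : nat) : Cmod (Cexp (RtoC (lam k) * s)%C) = exp (lam k * Re s).
Proof. rewrite Cmod_Cexp. f_equal. unfold Re, Cmult, RtoC; simpl. ring. Qed.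

(** Termwise differentiation: the remainder has terms exp(lam_k s) (exp(lam_k h) - 1 - lam_k h),
    small uniformly in k because the lam_k are bounded. *)
Lemma holo_at_exp_sum (s : C) : holo_at exp_sum s.
Proof.
set (B := exp (2 * Rabs (Re s))). assert (HB : 0 < B) by apply exp_pos.
assert (Hz : forall k, Cmod (Cexp (RtoC (lam k) * s)%C) <= B).
{ intro k. rewrite Cmod_Cexp_lam. apply exp_lam_bound. }
assert (HlamC : forall k, Cmod (RtoC (lam k)) = lam k).
{ intro k. rewrite Cmod_R, Rabs_pos_eq; [reflexivity|]. specialize (Hlam k). lra. }
assert (Hzl : forall k, Cmod (RtoC (lam k) * Cexp (RtoC (lam k) * s))%C <= 2 * B).
{ intro k. rewrite Cmod_mult, HlamC. specialize (Hlam k).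
  apply Rmult_le_compat; [lra|apply Cmod_ge_0|lra|apply Hz]. }
apply holo_at_eps. exists (csum (fun k => RtoC (lam k) * Cexp (RtoC (lam k) * s))%C).
intros eps He.
(* One factor 2 pays for [Cmod_csum_le], the other for |lam_k h| <= 2 |h|. *)
destruct (Cexp_remainder (eps / (4 * B))) as (d & Hd & Hrem).
{ apply Rdiv_lt_0_compat; lra. }
exists (d / 2); split; [lra|]. intros w Hw.
set (h := (w - s)%C) in *.
assert (Hzw : forall k, Cmod (Cexp (RtoC (lam k) * w)%C) <= exp (2 * Rabs (Re w))).
{ intro k. rewrite Cmod_Cexp_lam. apply exp_lam_bound. }
assert (Hneg : forall (u : C) (z : nat -> C) A, (forall k, Cmod (z k) <= A) ->
  forall k, Cmod (u * z k)%C <= Cmod u * A).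
{ intros u z A HA k. rewrite Cmod_mult. apply Rmult_le_compat_l; [apply Cmod_ge_0|apply HA]. }
assert (E : (exp_sum w - exp_sum s - csum (fun k => RtoC (lam k) * Cexp (RtoC (lam k) * s)) * h)%C =
  csum (fun k => Cexp (RtoC (lam k) * w) + (-1 * Cexp (RtoC (lam k) * s)
    + - h * (RtoC (lam k) * Cexp (RtoC (lam k) * s))))%C).
{ rewrite (csum_plus (fun k => Cexp (RtoC (lam k) * w)%C)
    (fun k => -1 * Cexp (RtoC (lam k) * s) + - h * (RtoC (lam k) * Cexp (RtoC (lam k) * s)))%C
    (exp (2 * Rabs (Re w))) (Cmod (-1) * B + Cmod (- h) * (2 * B))); [|exact Hzw|].
  - rewrite (csum_plus (fun k => -1 * Cexp (RtoC (lam k) * s))%C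
      (fun k => - h * (RtoC (lam k) * Cexp (RtoC (lam k) * s)))%C _ _ (Hneg _ _ _ Hz) (Hneg _ _ _ Hzl)).
    rewrite (csum_scal _ _ _ Hz), (csum_scal _ _ _ Hzl). fold (exp_sum s) (exp_sum w). ring.
  - intro k. eapply Rle_trans; [apply Cmod_triangle|].
    apply Rplus_le_compat; [exact (Hneg _ _ _ Hz k)|exact (Hneg _ _ _ Hzl k)]. }
rewrite E.
replace (eps * Cmod h) with (2 * (eps / 2 * Cmod h)) by field.
apply Cmod_csum_le. intro k.
replace (Cexp (RtoC (lam k) * w) + (-1 * Cexp (RtoC (lam k) * s)
    + - h * (RtoC (lam k) * Cexp (RtoC (lam k) * s))))%C
  with (Cexp (RtoC (lam k) * s) * (Cexp (RtoC (lam k) * h) - 1 - RtoC (lam k) * h))%C.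
2:{ replace (RtoC (lam k) * w)%C with (RtoC (lam k) * s + RtoC (lam k) * h)%C by (unfold h; ring).
    rewrite Cexp_plus. ring. }
rewrite Cmod_mult.
assert (Hh0 := Cmod_ge_0 h). specialize (Hlam k).
assert (Hlh : Cmod (RtoC (lam k) * h)%C <= 2 * Cmod h).
{ rewrite Cmod_mult, HlamC. apply Rmult_le_compat_r; lra. }
assert (R := Hrem (RtoC (lam k) * h)%C ltac:(lra)).
assert (Heb : 0 < eps / (4 * B)) by (apply Rdiv_lt_0_compat; lra).
apply Rle_trans with (B * (eps / (4 * B) * (2 * Cmod h))).
- apply Rmult_le_compat; [apply Cmod_ge_0|apply Cmod_ge_0|apply Hz|].
  eapply Rle_trans; [exact R|]. apply Rmult_le_compat_l; lra.
- right. field. lra.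
Qed.

Lemma real_exp_sum_pos (x : R) : 0 < real_exp_sum x.
Proof.
assert (H : c 0%nat * exp (lam 0%nat * x) <= real_exp_sum x).
{ apply (Series_ge_term (fun k => c k * exp (lam k * x))).
  - intro k. apply Rmult_le_pos; left; [apply Hc|apply exp_pos].
  - apply (ex_wsum _ (exp (2 * Rabs x))), Rabs_exp_lam_bound. }
eapply Rlt_le_trans; [|exact H]. apply Rmult_lt_0_compat; [apply Hc|apply exp_pos].
Qed.

Lemma real_exp_sum_le (x y : R) : x <= y -> real_exp_sum x <= real_exp_sum y.
Proof.
intros Hxy. apply (wsum_le _ _ (exp (2 * Rabs x)) (exp (2 * Rabs y)));
  try apply Rabs_exp_lam_bound.
intro k. apply exp_le_compat. specialize (Hlam k). apply Rmult_le_compat_l; lra.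
Qed.

(** All exponents exceed 1. The inequality trades a constant factor for a shift of x, which the
    flatness estimate absorbs into A^p. *)
Lemma real_exp_sum_shift (x t : R) : 0 <= t -> exp t * real_exp_sum x <= real_exp_sum (x + t).
Proof.
intros Ht. unfold real_exp_sum. rewrite <- wsum_scal.
apply (wsum_le _ _ (exp t * exp (2 * Rabs x)) (exp (2 * Rabs (x + t)))).
- intro k. rewrite Rabs_mult, (Rabs_pos_eq (exp t)) by (left; apply exp_pos).
  apply Rmult_le_compat_l; [left; apply exp_pos|apply Rabs_exp_lam_bound].
- apply Rabs_exp_lam_bound.
- intro k. rewrite <- exp_plus. apply exp_le_compat. specialize (Hlam k). nra.
Qed.

Lemma Rabs_exp_sum_le (s : C) :
  Rabs (fst (exp_sum s)) <= real_exp_sum (Re s) /\ Rabs (snd (exp_sum s)) <= real_exp_sum (Re s).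
Proof.
assert (H : forall p : C -> R, (forall z, Rabs (p z) <= Cmod z) ->
  Rabs (wsum (fun k => p (Cexp (RtoC (lam k) * s)%C))) <= real_exp_sum (Re s)).
{ intros p Hp.
  assert (Hk : forall k, Rabs (p (Cexp (RtoC (lam k) * s)%C)) <= exp (lam k * Re s)).
  { intro k. rewrite <- Cmod_Cexp_lam. apply Hp. }
  assert (HB : forall k, Rabs (p (Cexp (RtoC (lam k) * s)%C)) <= exp (2 * Rabs (Re s))).
  { intro k. eapply Rle_trans; [apply Hk|apply exp_lam_bound]. }
  apply Rabs_le_between. split.
  - apply Ropp_le_cancel. rewrite Ropp_involutive.
    replace (- wsum (fun k => p (Cexp (RtoC (lam k) * s)%C))) with
      (wsum (fun k => -1 * p (Cexp (RtoC (lam k) * s)%C))) by (rewrite wsum_scal; ring).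
    apply (wsum_le _ _ (exp (2 * Rabs (Re s))) (exp (2 * Rabs (Re s)))).
    + intro k. rewrite Rabs_mult, Rabs_m1, Rmult_1_l. apply HB.
    + apply Rabs_exp_lam_bound.
    + intro k. specialize (Hk k). apply Rabs_le_between in Hk. lra.
  - apply (wsum_le _ _ (exp (2 * Rabs (Re s))) (exp (2 * Rabs (Re s)))).
    + exact HB.
    + apply Rabs_exp_lam_bound.
    + intro k. specialize (Hk k). apply Rabs_le_between in Hk. lra. }
split; [apply (H fst), Rabs_fst_le_Cmod|apply (H snd), Rabs_snd_le_Cmod].
Qed.

Lemma cos_ge_of_Rabs_le (t u : R) : Rabs t <= u -> u <= PI -> cos u <= cos t.
Proof.
intros H Hu. replace (cos t) with (cos (Rabs t)).
- assert (P := Rabs_pos t). apply cos_decr_1; lra.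
- unfold Rabs. destruct Rcase_abs; [apply cos_neg|reflexivity].
Qed.

(* After multiplication by exp(-s) all terms have argument at most pi/4 in absolute value. *)
Lemma Cmod_exp_sum_ge (s : C) : Rabs (Im s) < PI / 2 -> real_exp_sum (Re s) / 2 <= Cmod (exp_sum s).
Proof.
intros Hs. assert (HPI := PI_RGT_0).
set (x := Re s) in *. set (y := Im s) in *. set (u := Cexp (0, - y)).
assert (Hu : Cmod u = 1) by (unfold u; rewrite Cmod_Cexp; simpl; apply exp_0).
assert (Hz : forall k, Cmod (Cexp (RtoC (lam k) * s)%C) <= exp (2 * Rabs x)).
{ intro k. rewrite Cmod_Cexp_lam. apply exp_lam_bound. }
replace (Cmod (exp_sum s)) with (Cmod (u * exp_sum s)%C) by (rewrite Cmod_mult, Hu; ring).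
eapply Rle_trans; [|apply Rabs_fst_le_Cmod]. eapply Rle_trans; [|apply Rle_abs].
unfold exp_sum. rewrite <- (csum_scal u _ _ Hz).
unfold Rdiv. rewrite Rmult_comm. unfold real_exp_sum. rewrite <- wsum_scal.
apply (wsum_le _ _ (/ 2 * exp (2 * Rabs x)) (exp (2 * Rabs x))).
- intro k. rewrite Rabs_mult, (Rabs_pos_eq (/ 2)) by lra.
  apply Rmult_le_compat_l; [lra|apply Rabs_exp_lam_bound].
- intro k. eapply Rle_trans; [apply Rabs_fst_le_Cmod|]. rewrite Cmod_mult, Hu, Rmult_1_l. apply Hz.
- intro k. unfold u. rewrite <- Cexp_plus.
  unfold Cexp, Cplus, Cmult, RtoC, Re, Im; simpl. fold (Re s) (Im s). fold x y.
  replace (0 + (lam k * x - 0 * y)) with (lam k * x) by ring.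
  replace (- y + (lam k * y + 0 * x)) with ((lam k - 1) * y) by ring.
  rewrite (Rmult_comm (/ 2)). apply Rmult_le_compat_l; [left; apply exp_pos|].
  (* As pi/4 < pi/3, the value cos(pi/3) = 1/2 is a convenient lower bound for all these cosines. *)
  replace (/ 2) with (cos (PI / 3)) by (rewrite cos_PI3; field).
  apply cos_ge_of_Rabs_le; [|lra]. specialize (Hlam k).
  rewrite Rabs_mult, (Rabs_pos_eq (lam k - 1)) by lra.
  assert (P := Rabs_pos y).
  apply Rle_trans with (1 / 2 * (PI / 2)); [apply Rmult_le_compat; lra|lra].
Qed.

Hypothesis Hdecr : forall k, lam (S k) < lam k.

Lemma lam_le (k n : nat) : (k <= n)%nat -> lam n <= lam k.
Proof.
induction 1 as [|n H IH]; [lra|]. specialize (Hdecr n). lra.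
Qed.

(* Towards the vertex the finitely many terms with exponent too large for the given
   opening are negligible with respect to the next one. *)
Lemma Re_exp_sum_ge (theta : R) (K : nat) : 0 <= theta -> lam (S K) * theta < PI / 2 ->
  exists q X, 0 < q <= 1 /\ forall s, Re s <= X -> Rabs (Im s) <= theta ->
    q / 2 * real_exp_sum (Re s) <= fst (exp_sum s).
Proof.
intros Ht HK. assert (HPI := PI_RGT_0).
set (q := cos (lam (S K) * theta)).
assert (HlS := Hlam (S K)).
assert (Hlt : 0 <= lam (S K) * theta) by (apply Rmult_le_pos; lra).
assert (Hq : 0 < q <= 1) by (split; [apply cos_gt_0; lra|apply COS_bound]).
assert (HcS := Hc (S K)). assert (Hd := Hdecr K).
(* For x <= 0 a larger exponent gives a smaller term, so exp(lam_K x) dominates all k <= K. The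
   second entry makes twice this at most q/2 times the term of index K + 1. *)
set (X := Rmin 0 (ln (q * c (S K) / 4) / (lam K - lam (S K)))).
exists q, X. split; [exact Hq|]. intros s Hs Hy.
set (x := Re s) in *. set (y := Im s) in *.
assert (Hx0 : x <= 0) by (eapply Rle_trans; [exact Hs|apply Rmin_l]).
assert (Hx1 : (lam K - lam (S K)) * x <= ln (q * c (S K) / 4)).
{ rewrite Rmult_comm. apply Rle_div_r; [lra|]. eapply Rle_trans; [exact Hs|apply Rmin_r]. }
assert (Hqc : 0 < q * c (S K) / 4).
{ apply Rdiv_lt_0_compat; [apply Rmult_lt_0_compat; lra|lra]. }
assert (HeK : 2 * exp (lam K * x) <= q / 2 * (c (S K) * exp (lam (S K) * x))).
{ replace (lam K * x) with ((lam K - lam (S K)) * x + lam (S K) * x) by ring.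
  rewrite exp_plus. assert (E0 := exp_pos (lam (S K) * x)).
  apply exp_le_compat in Hx1. rewrite exp_ln in Hx1 by exact Hqc.
  apply Rle_trans with (2 * (q * c (S K) / 4 * exp (lam (S K) * x))).
  - apply Rmult_le_compat_l; [lra|]. apply Rmult_le_compat_r; lra.
  - right. field. }
assert (Hterm : c (S K) * exp (lam (S K) * x) <= real_exp_sum x).
{ apply (Series_ge_term (fun k => c k * exp (lam k * x))).
  - intro k. apply Rmult_le_pos; left; [apply Hc|apply exp_pos].
  - apply (ex_wsum _ (exp (2 * Rabs x))), Rabs_exp_lam_bound. }
(* Termwise: for k > K the cosine is at least q; for k <= K the real part is at least - exp(lam_k
   x), and subtracting 2 exp(lam_K x) pays for that since q <= 1. *)
assert (Hsum : q * real_exp_sum x + - (2 * exp (lam K * x)) * wsum (fun _ => 1) <= fst (exp_sum s)).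
{ unfold real_exp_sum. rewrite <- !wsum_scal.
  assert (B1 : forall k, Rabs (q * exp (lam k * x)) <= q * exp (2 * Rabs x)).
  { intro k. rewrite Rabs_mult, (Rabs_pos_eq q) by lra.
    apply Rmult_le_compat_l; [lra|apply Rabs_exp_lam_bound]. }
  assert (B2 : nat -> Rabs (- (2 * exp (lam K * x)) * 1) <= Rabs (- (2 * exp (lam K * x)) * 1)) by (intros _; lra).
  rewrite <- (wsum_plus _ _ _ _ B1 B2).
  apply (wsum_le _ _ (q * exp (2 * Rabs x) + Rabs (- (2 * exp (lam K * x)) * 1)) (exp (2 * Rabs x))).
  - intro k. eapply Rle_trans; [apply Rabs_triang|].
    apply Rplus_le_compat; [apply B1|apply (B2 k)].
  - intro k. eapply Rle_trans; [apply Rabs_fst_le_Cmod|]. rewrite Cmod_Cexp_lam. apply exp_lam_bound.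
  - intro k. unfold Cexp, Cmult, RtoC, Re, Im; simpl. fold (Re s) (Im s). fold x y.
    replace (lam k * x - 0 * y) with (lam k * x) by ring.
    replace (lam k * y + 0 * x) with (lam k * y) by ring.
    assert (E0 := exp_pos (lam k * x)). assert (E1 := exp_pos (lam K * x)).
    assert (Hlk := Hlam k).
    destruct (Compare_dec.le_lt_dec k K) as [Hk|Hk].
    + assert (exp (lam k * x) <= exp (lam K * x)).
      { apply exp_le_compat. assert (L := lam_le k K Hk). nra. }
      assert (Cs := COS_bound (lam k * y)).
      assert (- exp (lam k * x) <= exp (lam k * x) * cos (lam k * y)) by nra.
      assert (q * exp (lam k * x) <= 1 * exp (lam k * x)) by (apply Rmult_le_compat_r; lra).
      lra.
    + assert (Cs : q <= cos (lam k * y)).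
      { apply cos_ge_of_Rabs_le; [|lra]. rewrite Rabs_mult, (Rabs_pos_eq (lam k)) by lra.
        assert (L := lam_le (S K) k Hk). apply Rmult_le_compat; try lra. apply Rabs_pos. }
      assert (q * exp (lam k * x) <= exp (lam k * x) * cos (lam k * y)).
      { rewrite Rmult_comm. apply Rmult_le_compat_l; lra. }
      lra. }
assert (W1 := wsum_1_bounds). assert (E1 := exp_pos (lam K * x)).
assert (2 * exp (lam K * x) * wsum (fun _ => 1) <= 2 * exp (lam K * x) * 1) by (apply Rmult_le_compat_l; lra).
assert (q / 2 * (c (S K) * exp (lam (S K) * x)) <= q / 2 * real_exp_sum x) by (apply Rmult_le_compat_l; lra).
lra.
Qed.

End WeightedSums.

(** * A nonzero flat function *)

(** The start 3/2 excludes zeros of the sum, and the limit 1 gives positive real parts up to the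
    full opening. *)
Definition flat_exponent (k : nat) : R := 1 + / (INR k + 2).

Lemma flat_exponent_bounds (k : nat) : 1 < flat_exponent k <= 3 / 2.
Proof.
unfold flat_exponent. assert (H := pos_INR k).
assert (0 < / (INR k + 2)) by (apply Rinv_0_lt_compat; lra).
assert (/ (INR k + 2) <= / 2) by (apply Rinv_le_contravar; lra). lra.
Qed.

Lemma flat_exponent_decr (k : nat) : flat_exponent (S k) < flat_exponent k.
Proof.
unfold flat_exponent. rewrite S_INR. assert (H := pos_INR k).
apply Rplus_lt_compat_l, Rinv_lt_contravar; [|lra]. apply Rmult_lt_0_compat; lra.
Qed.

Lemma flat_exponent_small (theta : R) : 0 <= theta < PI / 2 ->
  exists K, flat_exponent (S K) * theta < PI / 2.
Proof.
intros Ht. destruct (INR_unbounded (theta / (PI / 2 - theta))) as [K HK].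
exists K. unfold flat_exponent. rewrite S_INR. assert (H := pos_INR K).
assert (HK' : theta < (PI / 2 - theta) * INR K).
{ rewrite Rmult_comm. apply Rlt_div_l; [lra|exact HK]. }
apply Rmult_lt_reg_r with (INR K + 1 + 2); [lra|].
replace ((1 + / (INR K + 1 + 2)) * theta * (INR K + 1 + 2))
  with (theta * (INR K + 3) + theta) by (field; lra).
lra.
Qed.

Lemma exists_flat_coefficients (M : nat -> R) (gamma : R) :
  weight_sequence M -> 0 < gamma -> ~ Rbar_lt (omega M) (Finite gamma) ->
  exists c : nat -> R, (forall k, 0 < c k <= (1 / 2) ^ S k) /\
    forall k p x, c k * ((- (INR p * gamma * x) - ln (M p)) * exp (flat_exponent k * x))
      <= (1 / 2) ^ S k.
Proof.
intros HM Hg Hge.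
assert (Hex : forall k, exists C0, 0 < C0 /\
  forall p y, INR p * y - ln (M p) <= C0 * exp (flat_exponent k * y / gamma)).
{ intro k. apply associated_function_bound; try assumption. apply flat_exponent_bounds. }
pose (C0 := fun k => proj1_sig (constructive_indefinite_description _ (Hex k))).
assert (HC : forall k, 0 < C0 k /\
  forall p y, INR p * y - ln (M p) <= C0 k * exp (flat_exponent k * y / gamma)).
{ intro k. apply (proj2_sig (constructive_indefinite_description _ (Hex k))). }
(* The denominator 1 + C_k secures both c_k <= 2^(-k-1) and c_k C_k <= 2^(-k-1). *)
exists (fun k => (1 / 2) ^ S k / (1 + C0 k)).
assert (Hpow : forall k, 0 < (1 / 2) ^ S k) by (intro k; apply pow_lt; lra).
split.
- intro k. destruct (HC k) as [H0 _]. specialize (Hpow k). split.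
  + apply Rdiv_lt_0_compat; lra.
  + apply Rle_div_l; [lra|]. nra.
- intros k p x. destruct (HC k) as [H0 H]. specialize (Hpow k). specialize (H p (- gamma * x)).
  replace (flat_exponent k * (- gamma * x) / gamma) with (- (flat_exponent k * x)) in H by (field; lra).
  rewrite exp_Ropp in H. set (e := exp (flat_exponent k * x)) in *.
  assert (He : 0 < e) by apply exp_pos.
  assert (K : (- (INR p * gamma * x) - ln (M p)) * e <= C0 k).
  { apply Rle_trans with (C0 k * / e * e); [apply Rmult_le_compat_r; lra|right; field; lra]. }
  apply Rle_trans with ((1 / 2) ^ S k / (1 + C0 k) * (1 + C0 k)).
  + apply Rmult_le_compat_l; [left; apply Rdiv_lt_0_compat; lra|lra].
  + right. field. lra.
Qed.

Section FlatFunction.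

Variables (M : nat -> R) (gamma : R) (c : nat -> R).
Hypothesis (HM : weight_sequence M) (Hgamma : 0 < gamma).
Hypothesis (Hc : forall k, 0 < c k <= (1 / 2) ^ S k).
Hypothesis (Hcw : forall k p x,
  c k * ((- (INR p * gamma * x) - ln (M p)) * exp (flat_exponent k * x)) <= (1 / 2) ^ S k).

Let E := exp_sum c flat_exponent.
Let E0 := real_exp_sum c flat_exponent.

(** Division by gamma maps the strip |Im z| < gamma pi/2 of the chart onto |Im s| < pi/2, where
    [exp_sum] has no zero. *)
Definition flat_function (z : C) : C :=
  Cexp (- / exp_sum c flat_exponent (RtoC (/ gamma) * z))%C.

Lemma scaled_parts (z : C) : Re (RtoC (/ gamma) * z)%C = Re z / gamma /\
  Im (RtoC (/ gamma) * z)%C = Im z / gamma.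
Proof. unfold Re, Im, Cmult, RtoC; simpl. split; field; lra. Qed.

(** Summing the inequalities [Hcw] over k bounds the left side times E0(x) by the sum of the
    2^(-k-1), which is 1. *)
Lemma real_exp_sum_weight (p : nat) (x : R) : - (INR p * gamma * x) - ln (M p) <= / E0 x.
Proof.
assert (Hp := real_exp_sum_pos c Hc flat_exponent flat_exponent_bounds x). fold E0 in Hp.
set (v := - (INR p * gamma * x) - ln (M p)).
assert (H : v * E0 x <= 1).
{ apply Rle_trans with (2 := Req_le _ _ (proj2 Series_half)).
  unfold E0, real_exp_sum. rewrite <- wsum_scal.
  apply Rminus_le_0.
  assert (Hex1 : ex_series (fun k => c k * (v * exp (flat_exponent k * x)))).
  { apply (ex_wsum c Hc (fun k => v * exp (flat_exponent k * x)) (Rabs v * exp (2 * Rabs x))).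
    intro k. rewrite Rabs_mult. apply Rmult_le_compat_l; [apply Rabs_pos|].
    apply (Rabs_exp_lam_bound flat_exponent flat_exponent_bounds). }
  unfold wsum. rewrite <- Series_minus; [|apply Series_half|exact Hex1].
  apply Series_ge_0.
  - intro k. specialize (Hcw k p x). fold v in Hcw. lra.
  - apply (ex_series_minus (V := R_NormedModule) (fun k => (1 / 2) ^ S k) _ (proj1 Series_half) Hex1). }
apply (Rmult_le_reg_r (E0 x)); [exact Hp|]. rewrite Rinv_l; lra.
Qed.

Lemma exp_sum_neq_0 (s : C) : Rabs (Im s) < PI / 2 -> E s <> 0%C.
Proof.
intros Hs. apply Cmod_gt_0.
assert (H := Cmod_exp_sum_ge c Hc flat_exponent flat_exponent_bounds s Hs).
assert (Hp := real_exp_sum_pos c Hc flat_exponent flat_exponent_bounds (Re s)).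
unfold E. lra.
Qed.

Lemma holo_at_flat_function (z : C) : Rabs (Im z) < gamma * PI / 2 -> holo_at flat_function z.
Proof.
intros Hz. unfold flat_function. apply (holo_at_comp Cexp); [apply holo_at_Cexp|].
apply holo_at_ext_loc with (f := fun w => (-1 * / E (RtoC (/ gamma) * w))%C) (r := 1); [lra| |].
{ intros w _. unfold E. ring. }
apply holo_at_scal. apply (holo_at_inv (fun w => E (RtoC (/ gamma) * w)%C)).
- apply exp_sum_neq_0. rewrite (proj2 (scaled_parts z)).
  rewrite Rabs_div by lra. rewrite (Rabs_pos_eq gamma) by lra. apply Rlt_div_l; lra.
- apply (holo_at_comp E); [apply holo_at_exp_sum; [exact Hc|exact flat_exponent_bounds]|].
  apply holo_at_scal, holo_at_id.
Qed.

(** Near the vertex Re (1/E) >= d/E0(x) >= 1/E0(x - ln d), which exceeds the exponent of order p at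
    the shifted point; the shift costs d^(-gamma p). Away from the vertex everything is bounded. *)
Lemma flat_function_bound (theta : R) : 0 <= theta < PI / 2 ->
  exists C0 A, 0 < C0 /\ 0 < A /\ forall s p, Rabs (Im s) <= theta ->
    Cmod (Cexp (- / E s)%C) <= C0 * A ^ p * M p * exp (gamma * Re s) ^ p.
Proof.
intros Ht. destruct (flat_exponent_small theta Ht) as [K HK].
destruct (Re_exp_sum_ge c Hc flat_exponent flat_exponent_bounds flat_exponent_decr theta K
  (proj1 Ht) HK) as (q & X & Hq & Hre). fold E E0 in Hre.
assert (Epos : forall x, 0 < E0 x) by (apply real_exp_sum_pos; [exact Hc|exact flat_exponent_bounds]).
(* Re (1/E) = Re E / |E|^2 with Re E >= q E0/2 and |E|^2 <= 2 E0^2. *)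
set (d := q / 4). assert (Hd : 0 < d < 1) by (unfold d; lra).
assert (Hlnd : ln d < 0) by (rewrite <- ln_1; apply ln_increasing; lra).
(* For x > X, 3 = 2 + 1: the exponent - Re (1/E) is at most 2/E0(X), and [real_exp_sum_weight] costs
   another 1/E0(X). *)
exists (exp (3 / E0 X)), (exp (- (gamma * ln d))).
split; [apply exp_pos|]. split; [apply exp_pos|]. intros s p Hs.
assert (HMp : M p = exp (ln (M p))) by (rewrite exp_ln; [reflexivity|apply HM]).
rewrite HMp, !exp_pow_INR, <- !exp_plus, Cmod_Cexp. apply exp_le_compat.
set (x := Re s) in *. assert (Hx := Epos x). assert (HX := Epos X).
assert (HiX : 0 < / E0 X) by (apply Rinv_0_lt_compat; lra).
assert (Hpd : 0 <= INR p * - (gamma * ln d)).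
{ apply Rmult_le_pos; [apply pos_INR|]. nra. }
assert (HE0 : E s <> 0%C) by (apply exp_sum_neq_0; lra).
assert (Hmod := Cmod_gt_0 (E s)). assert (Hm : 0 < Cmod (E s)) by tauto. clear Hmod.
destruct (Rle_lt_dec x X) as [HxX|HxX].
- assert (Hinv : d / E0 x <= Re (/ E s)%C).
  { destruct (Rabs_exp_sum_le c Hc flat_exponent flat_exponent_bounds s) as [R1 R2].
    fold E E0 in R1, R2. fold x in R1, R2. specialize (Hre s HxX Hs). fold x in Hre.
    assert (N : fst (E s) ^ 2 + snd (E s) ^ 2 <= 2 * E0 x ^ 2).
    { rewrite <- (pow2_abs (fst (E s))), <- (pow2_abs (snd (E s))).
      assert (Rabs (fst (E s)) ^ 2 <= E0 x ^ 2) by (apply pow_incr; split; [apply Rabs_pos|exact R1]).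
      assert (Rabs (snd (E s)) ^ 2 <= E0 x ^ 2) by (apply pow_incr; split; [apply Rabs_pos|exact R2]).
      lra. }
    assert (N0 : 0 < fst (E s) ^ 2 + snd (E s) ^ 2).
    { assert (P := Cmod2_alt (E s)). unfold Re, Im in P. rewrite <- P. apply pow_lt, Hm. }
    unfold Re, Cinv; simpl fst.
    apply (proj1 (Rle_div_r _ _ _ N0)).
    apply Rle_trans with (d / E0 x * (2 * E0 x ^ 2)).
    - apply Rmult_le_compat_l; [|exact N]. left. apply Rdiv_lt_0_compat; lra.
    - replace (d / E0 x * (2 * E0 x ^ 2)) with (q / 2 * E0 x) by (unfold d; field; lra). exact Hre. }
  assert (Hshift := real_exp_sum_shift c Hc flat_exponent flat_exponent_bounds x (- ln d) ltac:(lra)).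
  fold E0 in Hshift. rewrite exp_Ropp, exp_ln in Hshift by lra.
  assert (Hw := real_exp_sum_weight p (x + - ln d)).
  assert (Hi : / E0 (x + - ln d) <= d / E0 x).
  { replace (d / E0 x) with (/ (/ d * E0 x)) by (field; lra).
    apply Rinv_le_contravar; [|exact Hshift].
    apply Rmult_lt_0_compat; [apply Rinv_0_lt_compat|]; lra. }
  replace (Re (- / E s)%C) with (- Re (/ E s)%C) by reflexivity.
  assert (0 < 3 / E0 X) by (apply Rdiv_lt_0_compat; lra).
  lra.
- assert (Hle := real_exp_sum_le c Hc flat_exponent flat_exponent_bounds X x ltac:(lra)). fold E0 in Hle.
  assert (Hi : / E0 x <= / E0 X) by (apply Rinv_le_contravar; lra).
  assert (Hge := Cmod_exp_sum_ge c Hc flat_exponent flat_exponent_bounds s ltac:(lra)).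
  fold E E0 in Hge. fold x in Hge.
  assert (H1 : Re (- / E s)%C <= 2 * / E0 X).
  { eapply Rle_trans; [apply Rle_abs|]. eapply Rle_trans; [apply re_le_Cmod|].
    rewrite Cmod_opp, Cmod_inv by exact HE0.
    apply Rle_trans with (/ (E0 x / 2)).
    - apply Rinv_le_contravar; lra.
    - replace (/ (E0 x / 2)) with (2 * / E0 x) by (field; lra). lra. }
  assert (Hw := real_exp_sum_weight p x).
  unfold Rdiv. lra.
Qed.

End FlatFunction.

(** The two edges of T belong to its closure, hence to G, hence to the open sector of opening gamma
    pi; so the extreme arguments are strictly inside. *)
Lemma proper_subsector_argument (gamma : R) (G T : LogSurface -> Prop) :
  sectorial_region gamma G -> proper_subsector T G ->
  exists theta, 0 <= theta < gamma * PI / 2 /\ forall z, T z -> Rabs (argument z) <= theta.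
Proof.
intros (_ & _ & Hsec & _) ((d & b & r & Hb & Hr & HT) & Hcl).
assert (HPI := PI_RGT_0). set (w := b * PI / 2).
assert (Hw : 0 < w) by (unfold w; apply Rdiv_lt_0_compat; [apply Rmult_lt_0_compat|]; lra).
assert (Hend : forall sg, sg = 1 \/ sg = -1 -> Rabs (d + sg * w) < gamma * PI / 2).
{ intros sg Hsg.
  assert (Hin : G (ln (r / 2), d + sg * w)).
  { apply Hcl. intros P [eps HP].
    (* The edge is approached from inside: t <= eps/2 stays in the neighbourhood, t <= w does not
       pass the bisecting direction. *)
    set (t := Rmin (eps / 2) w). assert (He := cond_pos eps).
    assert (Ht : 0 < t) by (apply Rmin_pos; lra).
    assert (Ht1 : t <= eps / 2) by apply Rmin_l. assert (Ht2 : t <= w) by apply Rmin_r.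
    exists (ln (r / 2), d + sg * (w - t)). split.
    - apply HP. split.
      + change (Rabs (ln (r / 2) - ln (r / 2)) < eps). rewrite Rminus_diag, Rabs_R0. lra.
      + change (Rabs (d + sg * (w - t) - (d + sg * w)) < eps).
        apply Rabs_def1; destruct Hsg as [-> | ->]; lra.
    - apply HT. split.
      + unfold argument; simpl. fold w. apply Rabs_def1; destruct Hsg as [-> | ->]; lra.
      + unfold modulus; simpl. rewrite exp_ln by lra. lra. }
  apply Hsec in Hin. unfold sector, argument in Hin; simpl in Hin.
  rewrite Rminus_0_r in Hin. exact Hin. }
exists (Rmax (Rabs (d + -1 * w)) (Rabs (d + 1 * w))). split; [split|].
- eapply Rle_trans; [apply Rabs_pos|apply Rmax_l].
- apply Rmax_lub_lt; apply Hend; tauto.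
- intros z Hz. apply HT in Hz. destruct Hz as [Hz _]. fold w in Hz.
  apply Rabs_def2 in Hz. apply RmaxAbs; lra.
Qed.

Lemma partial_sum_0 (z : C) (p : nat) : partial_sum (fun _ => RtoC 0) z p = 0%C.
Proof. induction p as [|p IH]; simpl; [reflexivity|]. rewrite IH. ring. Qed.

(** [borel_map] is defined by choice, so its value must be identified through uniqueness of the
    expansion. *)
Lemma borel_map_of_flat (M : nat -> R) (gamma : R) (G : LogSurface -> Prop) (f : LogSurface -> C) :
  weight_sequence M -> 0 < gamma -> sectorial_region gamma G -> holomorphic_on G f ->
  asymptotic_expansion M G f (fun _ => RtoC 0) ->
  in_class M G f /\ borel_map M G f = (fun _ => RtoC 0).
Proof.
intros HM Hg HG Hh Ha.
assert (Hf : in_class M G f) by (split; [exact Hh|exists (fun _ => RtoC 0); exact Ha]).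
split; [exact Hf|].
apply (asymptotic_expansion_unique M gamma G f); try assumption. apply borel_map_spec, Hf.
Qed.

(** If the inequality failed, [flat_function] and the zero function would share the zero expansion,
    although an exponential never vanishes. *)
Lemma omega_lt_of_injective (M : nat -> R) (gamma : R) (G : LogSurface -> Prop) :
  weight_sequence M -> 0 < gamma -> sectorial_region gamma G ->
  borel_map_injective M G -> Rbar_lt (omega M) (Finite gamma).
Proof.
intros HM Hg HG Hinj. apply NNPP; intro Hge.
destruct (exists_flat_coefficients M gamma HM Hg Hge) as (c & Hc & Hcw).
set (f := flat_function gamma c).
assert (HGs : forall z, G z -> Rabs (Im z) < gamma * PI / 2).
{ intros z Hz. destruct HG as (_ & _ & Hsec & _). apply Hsec in Hz.
  unfold sector, argument in Hz. rewrite Rminus_0_r in Hz. exact Hz. }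
destruct (borel_map_of_flat M gamma G f) as [F1 F2]; try assumption.
{ intros z Hz. apply ex_derive_holo_at. apply holo_at_flat_function; try assumption. apply HGs, Hz. }
{ intros T HT. destruct (proper_subsector_argument gamma G T HG HT) as (theta & Ht & HTt).
  destruct (flat_function_bound M gamma c HM Hg Hc Hcw (theta / gamma)) as (C0 & A & HC & HA & H).
  { split; [apply Rle_mult_inv_pos; lra|]. apply Rlt_div_l; lra. }
  exists C0, A. split; [exact HC|]. split; [exact HA|]. intros z p Hz.
  rewrite partial_sum_0. replace (f z - 0)%C with (f z) by ring.
  destruct (scaled_parts gamma Hg z) as [S1 S2].
  specialize (H (RtoC (/ gamma) * z)%C p). rewrite S1, S2 in H.
  replace (gamma * (Re z / gamma)) with (Re z) in H by (field; lra).
  apply H. rewrite Rabs_div by lra. rewrite (Rabs_pos_eq gamma) by lra.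
  apply Rle_div_l; [lra|]. replace (theta / gamma * gamma) with theta by (field; lra).
  apply HTt, Hz. }
destruct (borel_map_of_flat M gamma G (fun _ => RtoC 0)) as [Z1 Z2]; try assumption.
{ intros z _. apply ex_derive_holo_at, holo_at_const. }
{ intros T _. exists 1, 1. split; [lra|]. split; [lra|]. intros z p _.
  rewrite partial_sum_0. replace (0 - 0)%C with (RtoC 0) by ring. rewrite Cmod_0.
  repeat apply Rmult_le_pos; try lra.
  - apply pow_le; lra.
  - left; apply HM.
  - apply pow_le. left. apply exp_pos. }
destruct HG as (_ & _ & _ & Hsec). destruct (Hsec (gamma / 2) ltac:(lra)) as (rho & Hrho & HinG).
destruct (bounded_sector_point (gamma / 2) rho (rho / 2) ltac:(lra) ltac:(lra)) as [Hz _].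
apply HinG in Hz.
apply (Cexp_neq_0 (- / exp_sum c flat_exponent (RtoC (/ gamma) * (ln (rho / 2), 0)))%C).
exact (Hinj f _ F1 Z1 ltac:(rewrite F2, Z2; reflexivity) _ Hz).
Qed.

Theorem corollary3p16 (M : nat -> R) (gamma : R) (G : LogSurface -> Prop)
    (HM : weight_sequence M) (Hgamma : 0 < gamma)
    (HG : sectorial_region gamma G) :
  borel_map_injective M G <-> Rbar_lt (omega M) (Finite gamma).
Proof.
split.
- apply omega_lt_of_injective; assumption.
- apply injective_of_omega_lt; assumption.
Qed.
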